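(* Let $\Lambda$ be a finite-dimensional algebra over a field $k$. If $\Lambda$ admits a $\mathbb{Z}$-grading with respect to which some finitely generated right $\Lambda$-module $M$ is not gradable, then $\Lambda$ has a Prüfer module that is not of finite type. Hence $\Lambda$ has a generic module.
   Context: For a $\mathbb{Z}$-grading $\Lambda=\bigoplus_n\Lambda_n$, a graded right $\Lambda$-module is $M=\bigoplus_{n\in\mathbb{Z}}M_n$ with $M_i\Lambda_j\subseteq M_{i+j}$; a right $\Lambda$-module is gradable if it is isomorphic to the underlying module of some graded right $\Lambda$-module. A module $P$ is a Prüfer module if there exists a locally nilpotent surjective endomorphism $\phi$ of $P$ with $\ker\phi$ nonzero and of finite length (locally nilpotent: for each $x\in P$ there is $n$ with $\phi^n(x)=0$). A module has finite type if it is isomorphic to a direct summand of a direct sum of (arbitrarily many) copies of $X$ for some finite length module $X$. A $\Lambda$-module is generic if it is indecomposable, of finite length as a module over its endomorphism ring, and not finitely generated over $\Lambda$. *)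

(* Defs.v *)
From HB Require Import structures.
From mathcomp Require Import all_boot all_order all_algebra all_field.
From mathcomp Require Import boolp classical_sets functions cardinality.

Set Implicit Arguments.
Unset Strict Implicit.
Unset Printing Implicit Defensive.

Import GRing.Theory.

Local Open Scope classical_set_scope.
Local Open Scope ring_scope.

(* A right module over A is a left module over the converse ring A^c:
   x acted on by a on the right is (a : A^c) *: x. *)
Notation rmodType A := (lmodType A^c).

Definition ract (A : pzRingType) (M : rmodType A) (x : M) (a : A) : M :=
  (a : A^c) *: x.

Section Modules.
Variable R : pzRingType.
Implicit Types M N X : lmodType R.

Definition isomorphic M N : Prop := exists f : {linear M -> N}, bijective f.

Definition nonzero M : Prop := exists x : M, x != 0.

Definition finitely_generated M : Prop :=
  exists (n : nat) (g : 'I_n -> M),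
    forall x : M, exists a : 'I_n -> R, x = \sum_i a i *: g i.

(* For submodules S and T: S is maximal in T, i.e. T / S is simple. *)
Definition simple_factor M (S T : set M) : Prop :=
  S `<` T /\
  forall U : set M, submod_closed [in U] ->
    S `<=` U -> U `<=` T -> U = S \/ U = T.

(* S, as a module in its own right, has a composition series; its submodules
   are the submodules of M contained in S. *)
Definition finite_length_sub M (S : set M) : Prop :=
  exists (n : nat) (C : nat -> set M),
    [/\ C 0%N = [set 0], C n = S,
        (forall i, (i <= n)%N -> submod_closed [in C i])
      & (forall i, (i < n)%N -> simple_factor (C i) (C i.+1))].

Definition finite_length M : Prop := finite_length_sub [set: M].

Definition indecomposable M : Prop :=
  nonzero M /\
  forall N1 N2, isomorphic M (N1 * N2)%type -> ~ (nonzero N1 /\ nonzero N2).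

Definition locally_nilpotent M (phi : M -> M) : Prop :=
  forall x : M, exists n : nat, iter n phi x = 0.

Definition prufer M : Prop :=
  exists phi : {linear M -> M},
    [/\ locally_nilpotent phi,
        (forall y : M, exists x : M, phi x = y),
        (exists2 x : M, phi x = 0 & x != 0)
      & finite_length_sub [set x : M | phi x = 0]].

End Modules.

Section Copower.
Variables (R : pzRingType) (I : Type) (X : lmodType R).

Definition finsupp_pred : {pred I -> X} :=
  fun f => `[< finite_set [set i | f i != 0] >].

Fact finsupp_submod_closed : submod_closed finsupp_pred.
Proof.
split=> [|a f g]; rewrite !inE.
  by apply: sub_finite_set (finite_set0 I) => i /=; rewrite eqxx.
move=> ff fg.
apply: (@sub_finite_set _ _ ([set i | f i != 0] `|` [set i | g i != 0])).
  move=> i /=; apply: contra_neqP => /not_orP[/negP/negPn/eqP fi0].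
  move=> /negP/negPn/eqP gi0.
  by rewrite [LHS](_ : _ = a *: f i + g i)// fi0 gi0 scaler0 addr0.
by rewrite finite_setU.
Qed.

HB.instance Definition _ :=
  GRing.isSubmodClosed.Build R (I -> X) finsupp_pred finsupp_submod_closed.

(* The finitely supported functions I -> X, i.e. the direct sum of copies of X
   indexed by I. *)
Record copower := Copower {
  copower_val :> I -> X;
  _ : copower_val \in finsupp_pred }.

HB.instance Definition _ := [isSub for copower_val].
HB.instance Definition _ := [Choice of copower by <:].
HB.instance Definition _ :=
  [SubChoice_isSubLmodule of copower by <:].

End Copower.

Definition finite_type (R : pzRingType) (M : lmodType R) : Prop :=
  exists (X : lmodType R) (I : Type) (N : lmodType R),
    finite_length X /\ isomorphic (M * N)%type (copower I X).

Section EndomorphismRing.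
Variables (R : pzRingType) (M : lmodType R).

Definition endo : Type := {linear M -> M}.

HB.instance Definition _ := gen_eqMixin endo.
HB.instance Definition _ := gen_choiceMixin endo.

Lemma endoP (f g : endo) :
  (forall x, (f : {linear M -> M}) x = (g : {linear M -> M}) x) -> f = g.
Proof.
case: f => f [[af] [sf]]; case: g => g [[ag] [sg]] /= /funext fg; subst g.
by rewrite (Prop_irrelevance af ag) (Prop_irrelevance sf sg).
Qed.

Definition endo_zero : endo := \0 : {linear M -> M}.
Definition endo_one : endo := idfun : {linear M -> M}.
Definition endo_opp (f : endo) : endo := \- (f : {linear M -> M}).
Definition endo_add (f g : endo) : endo :=
  (f : {linear M -> M}) \+ (g : {linear M -> M}).
Definition endo_mul (f g : endo) : endo :=
  (f : {linear M -> M}) \o (g : {linear M -> M}).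

Fact endo_addA : associative endo_add.
Proof. by move=> f g h; apply: endoP => x /=; rewrite addrA. Qed.
Fact endo_addC : commutative endo_add.
Proof. by move=> f g; apply: endoP => x /=; rewrite addrC. Qed.
Fact endo_add0 : left_id endo_zero endo_add.
Proof. by move=> f; apply: endoP => x /=; rewrite add0r. Qed.
Fact endo_addN : left_inverse endo_zero endo_opp endo_add.
Proof. by move=> f; apply: endoP => x /=; rewrite addNr. Qed.

HB.instance Definition _ :=
  GRing.isZmodule.Build endo endo_addA endo_addC endo_add0 endo_addN.

Fact endo_mulA : associative endo_mul.
Proof. by move=> f g h; apply: endoP. Qed.
Fact endo_mul1l : left_id endo_one endo_mul.
Proof. by move=> f; apply: endoP. Qed.
Fact endo_mul1r : right_id endo_one endo_mul.
Proof. by move=> f; apply: endoP. Qed.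
Fact endo_mulDl : left_distributive endo_mul endo_add.
Proof. by move=> f g h; apply: endoP. Qed.
Fact endo_mulDr : right_distributive endo_mul endo_add.
Proof. by move=> f g h; apply: endoP => x /=; rewrite linearD. Qed.

HB.instance Definition _ := GRing.Zmodule_isPzRing.Build endo
  endo_mulA endo_mul1l endo_mul1r endo_mulDl endo_mulDr.

(* An alias of M carrying its left module structure over endo. *)
Definition endomod : Type := M.

HB.instance Definition _ := GRing.Zmodule.on endomod.

Definition endo_scale (f : endo) (x : endomod) : endomod :=
  (f : {linear M -> M}) x.

Fact endo_scaleA (f g : endo) x :
  endo_scale f (endo_scale g x) = endo_scale (f * g) x.
Proof. by []. Qed.
Fact endo_scale1 : left_id 1 endo_scale.
Proof. by []. Qed.
Fact endo_scaleDr : right_distributive endo_scale +%R.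
Proof. by move=> f x y; apply: (linearD (f : {linear M -> M})). Qed.
Fact endo_scaleDl x : {morph endo_scale^~ x : f g / f + g}.
Proof. by []. Qed.

HB.instance Definition _ := GRing.Zmodule_isLmodule.Build endo endomod
  endo_scaleA endo_scale1 endo_scaleDr endo_scaleDl.

End EndomorphismRing.

Definition generic (R : pzRingType) (M : lmodType R) : Prop :=
  [/\ indecomposable M, finite_length (endomod M : lmodType (endo M))
    & ~ finitely_generated M].

(* V is the internal direct sum of the subgroups C n *)
Definition direct_sum_decomposition (V : zmodType) (C : int -> set V) : Prop :=
  [/\ (forall n, zmod_closed [in C n]),
      (forall v : V, exists (s : seq int) (f : int -> V),
         (forall n, C n (f n)) /\ v = \sum_(n <- s) f n)
    & (forall (s : seq int) (f : int -> V),
         uniq s -> (forall n, C n (f n)) -> \sum_(n <- s) f n = 0 ->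
         forall n, n \in s -> f n = 0)].

Section Gradings.
Variables (k : fieldType) (A : falgType k).

Definition algebra_grading (A_ : int -> {vspace A}) : Prop :=
  direct_sum_decomposition (fun n => [set` A_ n]) /\
  forall i j (a b : A), a \in A_ i -> b \in A_ j -> a * b \in A_ (i + j).

(* The components are only required to be subgroups: they are then k-subspaces,
   since 1 lies in A_ 0. *)
Record graded_rmodule (A_ : int -> {vspace A}) := GradedRmodule {
  gr_sort :> rmodType A;
  gr_comp : int -> set gr_sort;
  gr_decomposition : direct_sum_decomposition gr_comp;
  gr_ract : forall i j x a,
    gr_comp i x -> a \in A_ j -> gr_comp (i + j) (ract x a) }.

Definition gradable (A_ : int -> {vspace A}) (M : rmodType A) : Prop :=
  exists N : graded_rmodule A_, isomorphic M N.

End Gradings.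

(* Main.v *)
Require Import Defs.
From HB Require Import structures.
From mathcomp Require Import all_boot all_order all_algebra all_field.
From mathcomp Require Import boolp classical_sets functions cardinality.
From mathcomp Require Import zify ring.

(** Why the key fact holds. A map X -> M[t,1/t] is a finite list of coefficients and a map back is
    one map M -> X for each power of t, so a composite is the degree 0 component of a graded
    endomorphism of X[t,1/t] of bounded support. If it is not nilpotent, Fitting's lemma, applied in
    all degrees at once, gives a non-zero idempotent. One of least rank has as image a
    finite-dimensional graded module N with local degree 0 endomorphism ring, so N is a graded
    direct summand of M[t,1/t]. At t = 1 this gives maps N -> M -> N whose composite, as a matrix
    indexed by degrees, is the identity on the diagonal and radical off it, hence invertible: N, its
    grading forgotten, is a direct summand of M.

    For the indecomposable summand, Zorn's lemma cannot be applied to direct summands, which are not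
    stable under unions of chains. It is applied to submodules onto which every finite family can be
    retracted ([locally_split]); finite endolength makes the retraction global
    ([locally_split_retract]). *)

(* Let A_n act on M[t,1/t] = M (x) k[t,1/t] through t^n; this module is graded,
   and tensoring over k[t,1/t] with k(t) or with k[t,1/t,1/(t-1)] / k[t,1/t]
   gives A-modules Q and P.  Multiplication by t - 1 makes P a Pruefer module
   with kernel M, and Q is finite-dimensional over k(t), hence of finite length
   over its endomorphism ring.  The key fact: if maps X -> M[t,1/t] -> X with X
   finite-dimensional do not all compose to nilpotent endomorphisms, then M has
   a nonzero gradable direct summand.  Splitting off gradable summands, we may
   assume that M has none.

   Suppose that P is a direct summand of a sum of copies of X.  The maps X -> P
   that lift to M[t,1/t,1/(t-1)] have finite codimension, and every composite
   X -> P -> X starting with such a map factors through M[t,1/t]; these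
   composites form a nil, hence nilpotent, ideal of End X, which forces P to be
   killed by a power of t - 1, a contradiction.

   A finite-dimensional direct summand of Q is one of M[t,1/t], as denominators
   can be cleared, so Q has none.  A module of finite length over its
   endomorphism ring has an indecomposable direct summand, and such a summand of
   Q is generic. *)

Set Implicit Arguments.
Unset Strict Implicit.
Unset Printing Implicit Defensive.

Import GRing.Theory.

Local Open Scope ring_scope.

(** * Spans and nilpotent sets of matrices *)

Section Spans.
Variable F : fieldType.

(** Take rows from Z of maximal rank: adjoining any z of Z cannot raise it. *)
Lemma ex_span n (Z : set 'rV[F]_n) :
  exists r (B : 'M[F]_(r, n)),
    (forall i, Z (row i B)) /\ forall z, Z z -> (z <= B)%MS.
Proof.
pose P j := `[< exists r (B : 'M[F]_(r, n)),
                  (forall i, Z (row i B)) /\ \rank B = j >].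
have exP : exists j, P j.
  exists 0%N; apply/asboolP; exists 0%N, (0 : 'M_(0, n)).
  by split=> [[]//|]; rewrite mxrank0.
have ubP j : P j -> (j <= n)%N.
  by move=> /asboolP [r [B [_ <-]]]; apply: rank_leq_col.
case: (ex_maxnP exP ubP) => j /asboolP [r [B [BZ Bj]]] maxj.
exists r, B; split=> // z Zz.
have sBz : (B <= col_mx B z)%MS by rewrite -addsmxE addsmxSl.
have [le_r] := mxrank_leqif_sup sBz.
have -> : \rank B = \rank (col_mx B z).
  apply/eqP; rewrite eqn_leq le_r Bj /=; apply: maxj; apply/asboolP.
  exists (r + 1)%N, (col_mx B z); split=> // i.
  rewrite -[i]splitK; case: (fintype.split i) => i' /=.
    by rewrite rowKu.
  by rewrite rowKd ord1 row_id.
by rewrite eqxx => /esym; rewrite col_mx_sub => /andP[].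
Qed.

Definition lin_closed n (Z : set 'rV[F]_n) :=
  Z 0 /\ forall a x y, Z x -> Z y -> Z (a *: x + y).

Lemma lin_closed_sum n (Z : set 'rV[F]_n) (I : Type) (s : seq I) (P : pred I)
    (a : I -> F) (f : I -> 'rV[F]_n) :
  lin_closed Z -> (forall i, Z (f i)) -> Z (\sum_(i <- s | P i) a i *: f i).
Proof.
move=> [Z0 ZD] Zf; elim: s => [|i s IHs]; first by rewrite big_nil.
by rewrite big_cons; case: ifP => // _; apply: ZD.
Qed.

Lemma lin_closed_span n (Z : set 'rV[F]_n) : lin_closed Z ->
  exists r (B : 'M[F]_(r, n)), forall z, Z z <-> (z <= B)%MS.
Proof.
move=> Zl; have [r [B [BZ ZB]]] := ex_span Z.
exists r, B => z; split=> [/ZB//|/submxP[D ->]].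
by rewrite mulmx_sum_row; apply: lin_closed_sum.
Qed.

(** The dimension of a subspace, made total on sets (0 on the others) so that it can serve as a rank
    function on sets of module elements. *)
Definition lin_rank n (Z : set 'rV[F]_n) : nat :=
  xget 0%N [set j | exists r (B : 'M[F]_(r, n)),
                     (forall z, Z z <-> (z <= B)%MS) /\ \rank B = j].

Lemma lin_rankP n (Z : set 'rV[F]_n) : lin_closed Z ->
  exists r (B : 'M[F]_(r, n)),
    (forall z, Z z <-> (z <= B)%MS) /\ \rank B = lin_rank Z.
Proof.
move=> Zl; have [r [B BZ]] := lin_closed_span Zl.
rewrite /lin_rank; case: xgetP => [j -> //|/(_ (\rank B)) []].
by exists r, B.
Qed.

Lemma lin_rank_le n (Z Z' : set 'rV[F]_n) :
  lin_closed Z -> lin_closed Z' -> (Z `<=` Z')%classic ->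
  (lin_rank Z <= lin_rank Z')%N.
Proof.
move=> /lin_rankP[r [B [ZB <-]]] /lin_rankP[r' [B' [ZB' <-]]] sZ.
apply: mxrankS; apply/row_subP => i.
by apply/ZB'/sZ/ZB; rewrite row_sub.
Qed.

Lemma lin_rank_lt n (Z Z' : set 'rV[F]_n) :
  lin_closed Z -> lin_closed Z' -> (Z `<` Z')%classic ->
  (lin_rank Z < lin_rank Z')%N.
Proof.
move=> Zl Zl' [sZ nsZ].
have := lin_rank_le Zl Zl' sZ; rewrite leq_eqVlt => /orP[/eqP|//].
case: (lin_rankP Zl) => r [B [ZB <-]]; case: (lin_rankP Zl') => r' [B' [ZB' <-]].
move=> eq_r; exfalso; apply: nsZ => z /ZB' zB'; apply/ZB.
have sB : (B <= B')%MS.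
  by apply/row_subP => i; apply/ZB'/sZ/ZB; rewrite row_sub.
have [_] := mxrank_leqif_sup sB; rewrite eq_r eqxx => /esym sB'.
exact: submx_trans sB'.
Qed.

End Spans.

Section Killing.
Variables (F : fieldType) (n : nat) (I : finType).
Variable S : I -> I -> set 'M[F]_n.

(** S is thought of as the morphisms of a category with object set I; a vector placed at i is killed
    when all composites of q morphisms starting at i annihilate it. *)
Fixpoint killed (q : nat) (i : I) (v : 'rV[F]_n) : Prop :=
  if q is q'.+1 then forall j s, S i j s -> killed q' j (v *m s) else v = 0.

Lemma killed_lin q i : lin_closed [set v | killed q i v].
Proof.
elim: q i => [|q IHq] i; split=> //=.
- by move=> a x y -> ->; rewrite scaler0 addr0.
- by move=> j s _; rewrite mul0mx; case: (IHq j).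
- move=> a x y kx ky j s Ss; rewrite mulmxDl -scalemxAl.
  by have [_ kD] := IHq j; apply: kD; [apply: kx|apply: ky].
Qed.

Lemma killed_mono q q' i v : (q <= q')%N -> killed q i v -> killed q' i v.
Proof.
elim: q q' i v => [|q IHq] [|q'] i v //= leq.
  by move=> -> j s _; rewrite mul0mx; have [] := killed_lin q' j.
by move=> k j s /k; apply: IHq.
Qed.

Lemma killed_span i r (B : 'M[F]_(r, n)) :
  (forall l, exists q, killed q i (row l B)) ->
  exists q, forall v, (v <= B)%MS -> killed q i v.
Proof.
move=> /choice[q kq]; exists (\max_l q l)%N => v /submxP[D ->].
rewrite mulmx_sum_row.
apply: (lin_closed_sum _ _ _ (killed_lin (\max_l q l) i)) => l /=.
by apply: killed_mono (kq l); apply: leq_bigmax.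
Qed.

Hypothesis S_lin : forall i j, S i j 0 /\
  forall a x y, S i j x -> S i j y -> S i j (a *: x + y).
Hypothesis S_mul : forall i j l x y, S i j x -> S j l y -> S i l (x *m y).
Hypothesis S_nil : forall i x, S i i x -> exists e, x ^+ e = 0.

Let orb i v j : set 'rV[F]_n := [set w | exists2 s, S i j s & w = v *m s].

Let orb_lin i v j : lin_closed (orb i v j).
Proof.
have [S0 SD] := S_lin i j.
split=> [|a x y [s Ss ->] [s' Ss' ->]]; first by exists 0; rewrite ?mulmx0.
by exists (a *: s + s'); [apply: SD | rewrite mulmxDr -scalemxAr].
Qed.

Let orb_fixed i v : orb i v i v -> v = 0.
Proof.
move=> [s /S_nil[e se] vs].
have {se} : v *m s ^+ e = 0 by rewrite se mulmx0.
elim: e => [|e IHe]; first by rewrite expr0 mulmx1.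
by rewrite exprS mulmxA -vs.
Qed.

(* Levitzki's theorem for finite-dimensional nil algebras, with several objects
   so that it also applies to the homogeneous endomorphisms of a graded module. *)
Lemma nil_killed : exists q, forall i v, killed q i v.
Proof.
(* Induction on the total dimension of the spaces v S i j. For w in v S i j, all w S j l lie in v S
   i l, strictly for l = j: w belongs to w S j j only if w = 0. Each v S i j is spanned by finitely
   many such w, which gives a uniform q. *)
have kall i v : exists q, killed q i v.
  have [N] := ubnP (\sum_j lin_rank (orb i v j))%N.
  elim: N i v => // N IHN i v; rewrite ltnS => leN.
  have kw j w : orb i v j w -> exists q, killed q j w.
    move=> vw; have [/orb_fixed ->|nww] := pselect (orb j w j w).
      by exists 0%N.
    have sub l : (orb j w l `<=` orb i v l)%classic.
      move=> _ [s Ss ->]; have [s' Ss' ->] := vw.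
      by exists (s' *m s); [apply: S_mul Ss | rewrite mulmxA].
    apply: IHN; apply: leq_trans leN.
    rewrite (bigD1 j)//= [ltnRHS](bigD1 j)//= -addSn leq_add//.
      apply: lin_rank_lt => //; split; first exact: sub.
      by move=> /(_ _ vw).
    by apply: leq_sum => l _; apply: lin_rank_le.
  have /choice[q kq] : forall j, exists q, forall w, orb i v j w -> killed q j w.
    move=> j; have [r [B BP]] := lin_closed_span (orb_lin i v j).
    have [l|q kq] := @killed_span j r B.
      by apply/kw/BP; rewrite row_sub.
    by exists q => w /BP /kq.
  exists (\max_j q j).+1%N => j s Ss.
  apply: (@killed_mono (q j)); first exact: leq_bigmax.
  by apply: kq; exists s.
have /choice[q kq] : forall i, exists q, forall v, killed q i v.
  move=> i; have [l|q kq] := @killed_span i n 1%:M; first exact: kall.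
  by exists q => v; apply/kq/submx1.
exists (\max_i q i)%N => i v.
by apply: killed_mono (kq i v); apply: leq_bigmax.
Qed.

End Killing.

Lemma sum_support (V : nmodType) (T : eqType) (s s' : seq T) (f : T -> V) :
  uniq s -> uniq s' -> (forall i, f i != 0 -> i \in s) ->
  (forall i, f i != 0 -> i \in s') -> \sum_(i <- s) f i = \sum_(i <- s') f i.
Proof.
have sumE (t : seq T) : \sum_(i <- t) f i = \sum_(i <- t | f i != 0) f i.
  rewrite (bigID (fun i => f i != 0))/= [X in _ + X]big1 ?addr0// => i.
  by move=> /negPn/eqP.
move=> us us' ss ss'; rewrite (sumE s) (sumE s') -big_filter -[RHS]big_filter.
apply: perm_big; apply: uniq_perm; rewrite ?filter_uniq// => i.
rewrite !mem_filter; case: (boolP (f i != 0)) => //= fi.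
by rewrite ss ?ss'.
Qed.

Section FittingPolynomial.
Variables (k : fieldType) (n : nat).

(** [e] is the Fitting idempotent of y. One h serves the whole list, because evaluating a single
    polynomial at all members of a graded family gives a graded family again ([gfamily_horner]). *)
Lemma fitting_poly (ys : seq 'M[k]_n.+1) : exists h : {poly k},
  forall y, y \in ys -> let e := y *m horner_mx y h in
    e *m e = e /\ exists q, y ^+ q *m (1%:M - e) = 0.
Proof.
pose p : {poly k} := \prod_(y <- ys) char_poly y.
have p0 : p != 0.
  by rewrite monic_neq0// monic_prod// => y _; apply: char_poly_monic.
have [m [q q0 pE]] := multiplicity_XsubC p 0.
rewrite p0/= in q0; rewrite subr0 in pE.
(* The exponent m + 1, rather than m, leaves a factor X in f even when m = 0, so that e = f(y) is a
   multiple of y. *)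
have /Bezout_eq1_coprimepP[[u v]/= uv] : coprimep ('X^(m.+1)) q.
  by rewrite coprimep_expl// -[X in coprimep X _]subr0 -polyC0
    coprimep_sym coprimep_XsubC.
pose f := u * 'X^(m.+1).
exists (u * 'X^m) => y y_ys; set e := y *m _.
have yp : horner_mx y p = 0.
  rewrite /p (big_rem y)//= rmorphM/=.
  by rewrite (_ : horner_mx y (char_poly y) = 0) ?mul0r// Cayley_Hamilton.
have eE : e = horner_mx y f.
  rewrite /e -[X in X *m _]horner_mx_X -[_ *m _]rmorphM/= /f exprS.
  by congr horner_mx; ring.
have e1E : 1%:M - e = horner_mx y (v * q).
  by rewrite eE -[1%:M](rmorph1 (horner_mx y)) -uv -rmorphB addrAC subrr add0r.
split.
  apply/eqP; rewrite -subr_eq0 -[X in _ - X]mulmx1 -mulmxBr -opprB mulmxN oppr_eq0.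
  rewrite e1E eE -[_ *m _]rmorphM /f.
  have -> : u * 'X^(m.+1) * (v * q) = u * v * 'X * p by rewrite pE exprS; ring.
  by rewrite rmorphM/= yp mulr0.
exists m.
rewrite e1E -[X in X ^+ m]horner_mx_X -rmorphXn -[_ *m _]rmorphM/=.
have -> : 'X^m * (v * q) = v * p by rewrite pE; ring.
by rewrite rmorphM/= yp mulr0.
Qed.

End FittingPolynomial.

(** * Graded maps between Laurent modules *)

Section Families.
Variables (k : fieldType) (A : falgType k) (A_ : int -> {vspace A}).

(* Families of linear maps that commute with the action up to a shift by the
   degree: they are the graded maps X[t,1/t] -> Y[t,1/t], x t^i |-> g_i(x) t^i,
   where the element a of degree n acts on X[t,1/t] and Y[t,1/t] as t^n a. *)
Definition gfamily d e (s : A -> 'M[k]_d) (r : A -> 'M[k]_e)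
    (g : int -> 'M[k]_(d, e)) :=
  forall n a i, a \in A_ n -> s a *m g (i + n) = g i *m r a.

Definition bounded_by (B : nat) d e (g : int -> 'M[k]_(d, e)) :=
  forall i : int, (B < `|i|)%N -> g i = 0.

Definition bounded d e (g : int -> 'M[k]_(d, e)) := exists B, bounded_by B g.

Section FamilyTheory.
Variables (d e : nat) (s : A -> 'M[k]_d) (r : A -> 'M[k]_e).

Lemma gfamily0 : gfamily s r (fun=> 0).
Proof. by move=> n a i _; rewrite mulmx0 mul0mx. Qed.

Lemma gfamilyD g h :
  gfamily s r g -> gfamily s r h -> gfamily s r (fun i => g i + h i).
Proof. by move=> sg sh n a i An; rewrite mulmxDr mulmxDl sg ?sh. Qed.

Lemma gfamilyZ c g : gfamily s r g -> gfamily s r (fun i => c *: g i).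
Proof. by move=> sg n a i An; rewrite -scalemxAr -scalemxAl sg. Qed.

Lemma gfamily_shift c g : gfamily s r g -> gfamily s r (fun i => g (i + c)).
Proof. by move=> sg n a i An; rewrite addrAC sg. Qed.

Lemma gfamily_sum (I : finType) (g : I -> int -> 'M[k]_(d, e)) :
  (forall l, gfamily s r (g l)) -> gfamily s r (fun i => \sum_l g l i).
Proof.
move=> sg n a i An; rewrite mulmx_sumr mulmx_suml.
by apply: eq_bigr => l _; apply: sg.
Qed.

Lemma gfamily_mul f (u : A -> 'M[k]_f) g h :
  gfamily s r g -> gfamily r u h -> gfamily s u (fun i => g i *m h i).
Proof. by move=> sg sh n a i An; rewrite mulmxA sg// -!mulmxA sh. Qed.

End FamilyTheory.

Lemma bounded_shift d e c (g : int -> 'M[k]_(d, e)) :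
  bounded g -> bounded (fun i => g (i + c)).
Proof. by move=> [B gB]; exists (B + `|c|)%N => i iB; apply: gB; lia. Qed.

Lemma gfamily_horner d (s : A -> 'M[k]_d.+1) g (h : {poly k}) :
  gfamily s s g -> gfamily s s (fun i => horner_mx (g i) h).
Proof.
move=> sg; elim/poly_ind: h => [|p c IHp] n a i An.
  by rewrite !rmorph0 mulmx0 mul0mx.
rewrite !rmorphD/= !rmorphM/= !horner_mx_X !horner_mx_C.
rewrite mulmxDr mulmxDl scalar_mxC; congr (_ + _).
by rewrite -[_ * g (i + n)]/(_ *m _) mulmxA IHp// -mulmxA sg// mulmxA.
Qed.

Section Factor.
Variables (m : nat) (rho : A -> 'M[k]_m).

(* The graded endomorphisms of X[t,1/t] of bounded support that factor through
   a finite direct sum of copies of M[t,1/t], where M is given by rho. *)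
Definition factors d (s : A -> 'M[k]_d) (th : int -> 'M[k]_d) :=
  exists r (io : 'I_r -> int -> 'M[k]_(d, m)) (pi : 'I_r -> int -> 'M[k]_(m, d)),
    [/\ forall l, gfamily s rho (io l) /\ bounded (io l),
        forall l, gfamily rho s (pi l)
      & forall i, th i = \sum_l io l i *m pi l i].

Section FactorTheory.
Variables (d : nat) (s : A -> 'M[k]_d).

Lemma factors_gfamily th : factors s th -> gfamily s s th.
Proof.
move=> [r [io [pi [sio spi thE]]]] n a i An; rewrite !thE.
apply: (gfamily_sum (g := fun l j => io l j *m pi l j)) An => l.
by apply: gfamily_mul (spi l); have [] := sio l.
Qed.

Lemma factors_bounded th : factors s th -> bounded th.
Proof.
move=> [r [io [pi [sio spi thE]]]].
have /choice[B iB] : forall l, bounded (io l) by move=> l; have [] := sio l.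
exists (\max_l B l)%N => i iM; rewrite thE big1// => l _.
by rewrite iB ?mul0mx//; apply: leq_ltn_trans iM; apply: leq_bigmax.
Qed.

Lemma factors0 : factors s (fun=> 0).
Proof.
exists 0%N, (fun _ _ => 0), (fun _ _ => 0).
by split=> [[]|[]|i]//; rewrite big_ord0.
Qed.

Lemma factors_pair io pi : gfamily s rho io -> bounded io -> gfamily rho s pi ->
  factors s (fun i => io i *m pi i).
Proof.
move=> sio bio spi; exists 1%N, (fun=> io), (fun=> pi).
by split=> // i; rewrite big_ord1.
Qed.

Lemma factorsD th th' : factors s th -> factors s th' ->
  factors s (fun i => th i + th' i).
Proof.
move=> [r [io [pi [sio spi thE]]]] [r' [io' [pi' [sio' spi' thE']]]].
exists (r + r')%N,
  (fun l => match fintype.split l with inl l => io l | inr l => io' l end),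
  (fun l => match fintype.split l with inl l => pi l | inr l => pi' l end).
split=> [l|l|i]; try by case: fintype.split.
rewrite thE thE' big_split_ord/=; congr (_ + _); apply: eq_bigr => l _.
  by rewrite (unsplitK (inl l)).
by rewrite (unsplitK (inr l)).
Qed.

Lemma factors_mulr th h : factors s th -> gfamily s s h ->
  factors s (fun i => th i *m h i).
Proof.
move=> [r [io [pi [sio spi thE]]]] sh.
exists r, io, (fun l i => pi l i *m h i); split=> // [l|i].
  exact: gfamily_mul (spi l) sh.
by rewrite thE mulmx_suml; apply: eq_bigr => l _; rewrite mulmxA.
Qed.

Lemma factors_shift c th : factors s th -> factors s (fun i => th (i + c)).
Proof.
move=> [r [io [pi [sio spi thE]]]].
exists r, (fun l i => io l (i + c)), (fun l i => pi l (i + c)).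
split=> // l; last exact: gfamily_shift.
have [fi bi] := sio l.
by split; [apply: gfamily_shift|apply: bounded_shift].
Qed.

Lemma factorsZ c th : factors s th -> factors s (fun i => c *: th i).
Proof.
move=> [r [io [pi [sio spi thE]]]].
exists r, io, (fun l i => c *: pi l i); split=> // [l|i]; first exact: gfamilyZ.
by rewrite thE scaler_sumr; apply: eq_bigr => l _; rewrite scalemxAr.
Qed.

Lemma factors_sum (I : Type) (t : seq I) (th : I -> int -> 'M[k]_d) :
  (forall l, factors s (th l)) -> factors s (fun i => \sum_(l <- t) th l i).
Proof.
move=> sth; elim: t => [|l t IHt].
  by rewrite (_ : (fun _ => _) = (fun=> 0)); [apply: factors0|
    apply/funext => i; rewrite big_nil].
rewrite (_ : (fun _ => _) = (fun i => th l i + \sum_(l <- t) th l i)).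
  exact: factorsD.
by apply/funext => i; rewrite big_cons.
Qed.

End FactorTheory.
End Factor.
End Families.

(** * Graded endomorphisms factoring through M[t,1/t] *)

Section NilpotentMatrices.
Variables (k : fieldType) (n : nat).
Implicit Types y z e : 'M[k]_n.

(** As e is a left unit for y, the equation z y = e iterates to z^j y^j = e for j >= 1. *)
Lemma nil_left_inverse y z e N :
  y ^+ N = 0 -> e *m y = y -> z *m y = e -> e = 0.
Proof.
move=> yN ey zy; have zyj j : z ^+ j.+1 *m y ^+ j.+1 = e.
  elim: j => [|j IHj]; first by rewrite !expr1.
  have -> : z ^+ j.+2 = z ^+ j.+1 *m z by rewrite exprSr.
  have -> : y ^+ j.+2 = y *m y ^+ j.+1 by rewrite exprS.
  have ey' : e *m y ^+ j.+1 = y ^+ j.+1 by rewrite exprS mulmxA ey.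
  by rewrite -mulmxA [z *m (_ *m _)]mulmxA zy ey'.
by rewrite -(zyj N) [y ^+ _]exprS yN mulr0 mulmx0.
Qed.

Lemma nil_right_inverse y z e N :
  y ^+ N = 0 -> y *m e = y -> y *m z = e -> e = 0.
Proof.
move=> yN ey yz; have yzj j : y ^+ j.+1 *m z ^+ j.+1 = e.
  elim: j => [|j IHj]; first by rewrite !expr1.
  have -> : y ^+ j.+2 = y ^+ j.+1 *m y by rewrite exprSr.
  have -> : z ^+ j.+2 = z *m z ^+ j.+1 by rewrite exprS.
  have ye : y ^+ j.+1 *m e = y ^+ j.+1 by rewrite exprSr -mulmxA ey.
  by rewrite -mulmxA [y *m (_ *m _)]mulmxA yz mulmxA ye.
by rewrite -(yzj N) [y ^+ _]exprS yN mulr0 mul0mx.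
Qed.

End NilpotentMatrices.

(** Lists the integers from -B to B, so that sums over degrees and the objects of [killed] are
    indexed by ordinals. *)
Definition window B (i : 'I_(B.*2.+1)) : int := i%:Z - B%:Z.

Lemma windowP B (j : int) : (`|j| <= B)%N ->
  exists i : 'I_(B.*2.+1), window i = j.
Proof.
move=> jB; have lt_j : (`|(j + B%:Z)%R| < B.*2.+1)%N by lia.
by exists (Ordinal lt_j); rewrite /window /=; lia.
Qed.

Lemma window_inj B : injective (@window B).
Proof. by move=> i j; rewrite /window => ij; apply: ord_inj; lia. Qed.

Lemma sum_window (V : nmodType) B (t : seq int) (f : int -> V) :
  uniq t -> (forall i, f i != 0 -> i \in t) ->
  (forall i, (B < `|i|)%N -> f i = 0) ->
  \sum_(i < B.*2.+1) f (window i) = \sum_(i <- t) f i.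
Proof.
move=> ut ft fB.
rewrite -(big_enum _ _ (fun=> true) (fun i => f (window i))) -(big_map _ xpredT).
apply: sum_support => // [|i fi].
  by rewrite map_inj_uniq ?enum_uniq//; apply: window_inj.
have [|j <-] := @windowP B i; last by apply: map_f; rewrite mem_enum.
by apply: contra_neqT fi; rewrite -ltnNge => /fB.
Qed.

Section GradedSummand.
Variables (k : fieldType) (A : falgType k) (A_ : int -> {vspace A}).
Variables (m : nat) (rho : A -> 'M[k]_m).

(** The sum of the q i is then an idempotent commuting with homogeneous elements, and its image,
    graded by the images of the q i, is a gradable direct summand of M. *)
Definition graded_idempotents (q : int -> 'M[k]_m) :=
  [/\ gfamily A_ rho rho q, bounded q
    & forall i j, q i *m q j = if i == j then q i else 0].

(** The sum is F at t = 1: summing over all degrees makes the shift by n disappear. *)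
Lemma gfamily_sum_comm B F n a : gfamily A_ rho rho F -> bounded_by B F ->
  a \in A_ n -> comm_mx (rho a) (\sum_(i < B.*2.+1) F (window i)).
Proof.
move=> fF FB An; rewrite /comm_mx mulmx_sumr mulmx_suml.
(* This wider window and its translate by n both contain the support of F. *)
pose t := [seq window i | i : 'I_((B + `|n|).*2.+1)].
have ut : uniq t by rewrite map_inj_uniq ?enum_uniq//; apply: window_inj.
have tP i : (`|i| <= B + `|n|)%N -> i \in t.
  by move=> /windowP[j <-]; apply: map_f; rewrite mem_enum.
have FtB i : F i != 0 -> (`|i| <= B)%N.
  by apply: contra_neqT; rewrite -ltnNge => /FB.
rewrite (sum_window (f := fun i => rho a *m F i) (t := [seq i + n | i <- t])).
- rewrite big_map (sum_window (f := fun i => F i *m rho a) ut).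
  + by apply: eq_bigr => i _; apply: fF.
  + move=> i Fi; apply: tP.
    have : F i != 0 by apply: contra_neq Fi => ->; rewrite mul0mx.
    by move=> /FtB; lia.
  + by move=> i /FB ->; rewrite mul0mx.
- by rewrite map_inj_uniq//; apply: addIr.
- move=> i Fi; apply/mapP; exists (i - n); rewrite ?subrK//; apply: tP.
  have : F i != 0 by apply: contra_neq Fi => ->; rewrite mulmx0.
  by move=> /FtB; lia.
- by move=> i /FB ->; rewrite mulmx0.
Qed.

Section Minimal.
Variables (d : nat) (s : A -> 'M[k]_d.+1).

Definition idempotent_factor B (e : int -> 'M[k]_d.+1) :=
  [/\ factors A_ rho s e, bounded_by B e, forall i, e i *m e i = e i
    & exists i, e i != 0].

Definition total_rank B (e : int -> 'M[k]_d.+1) :=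
  (\sum_(i < B.*2.+1) \rank (e (window i)))%N.

Variables (B : nat) (eps : int -> 'M[k]_d.+1).
Hypothesis eps_idem : idempotent_factor B eps.
Hypothesis eps_min : forall e, idempotent_factor B e ->
  (total_rank B eps <= total_rank B e)%N.

Let epsF : factors A_ rho s eps. Proof. by have [] := eps_idem. Qed.
Let epsB : bounded_by B eps. Proof. by have [] := eps_idem. Qed.
Let epsK i : eps i *m eps i = eps i. Proof. by have [] := eps_idem. Qed.

(* The maps of degree c of the graded module N with components X *m eps i. *)
Let hom c (y : int -> 'M[k]_d.+1) :=
  gfamily A_ s s y /\ forall i, eps i *m y i = y i /\ y i *m eps (i + c) = y i.

Let nil (y : int -> 'M[k]_d.+1) := forall i, exists N, y i ^+ N = 0.

Let no_left_inverse y z : hom 0 y -> nil y -> ~ (forall i, z i *m y i = eps i).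
Proof.
move=> [_ hy] ny zy; have [_ _ _ [i /eqP]] := eps_idem; apply.
have [N yN] := ny i; have [ey _] := hy i; exact: nil_left_inverse yN ey (zy i).
Qed.

Let no_right_inverse y z : hom 0 y -> nil y -> ~ (forall i, y i *m z i = eps i).
Proof.
move=> [_ hy] ny yz; have [_ _ _ [i /eqP]] := eps_idem; apply.
have [N yN] := ny i; have [_] := hy i; rewrite addr0 => ye.
exact: nil_right_inverse yN ye (yz i).
Qed.

Let hom_mul c c' y y' : hom c y -> hom c' y' ->
  hom (c + c') (fun i => y i *m y' (i + c)).
Proof.
move=> [fy hy] [fy' hy']; split.
  by apply: gfamily_mul; [exact: fy|apply: gfamily_shift].
move=> i; have [ey ye] := hy i; have [ey' ye'] := hy' (i + c).
by rewrite mulmxA ey -mulmxA addrA ye'.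
Qed.

Let hom0_mul y y' : hom 0 y -> hom 0 y' -> hom 0 (fun i => y i *m y' i).
Proof.
move=> hy hy'; have := hom_mul hy hy'; rewrite addr0.
by rewrite (_ : (fun _ => _) = (fun i => y i *m y' i))//; apply/funext => i;
  rewrite addr0.
Qed.

Let homD c y y' : hom c y -> hom c y' -> hom c (fun i => y i + y' i).
Proof.
move=> [fy hy] [fy' hy']; split; first exact: gfamilyD.
move=> i; have [ey ye] := hy i; have [ey' ye'] := hy' i.
by rewrite mulmxDr mulmxDl ey ye ey' ye'.
Qed.

Let homZ c a y : hom c y -> hom c (fun i => a *: y i).
Proof.
move=> [fy hy]; split; first exact: gfamilyZ.
by move=> i; have [ey ye] := hy i; rewrite -scalemxAr -scalemxAl ey ye.
Qed.

Let hom_eps : hom 0 eps.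
Proof. by split=> [|i]; [apply: factors_gfamily epsF|rewrite addr0 !epsK]. Qed.

(* Minimality of eps makes the degree zero endomorphism ring of N local. *)
Let nil_or_unit y : hom 0 y -> nil y \/
  exists2 z, hom 0 z & forall i, y i *m z i = eps i /\ z i *m y i = eps i.
Proof.
move=> hy; have [fy yeps] := hy.
have ey i : eps i *m y i = y i by have [] := yeps i.
have ye i : y i *m eps i = y i by have [_] := yeps i; rewrite addr0.
(* The Fitting idempotents e i of all y i at once. They vanish if y is nil; otherwise they form
   another idempotent factor, since y = eps y. *)
have [h hP] := fitting_poly [seq y (window i) | i : 'I_(B.*2.+1)].
pose hy' i := horner_mx (y i) h.
pose e i := y i *m hy' i.
have e_out i : (B < `|i|)%N -> e i = 0.
  by move=> iB; rewrite /e -ey epsB// !mul0mx.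
have comm_yh i : y i *m hy' i = hy' i *m y i by apply: comm_mx_horner.
have eP i : e i *m e i = e i /\ exists q, y i ^+ q *m (1%:M - e i) = 0.
  have [iB|iB] := ltnP B `|i|.
    rewrite e_out// mulmx0; split=> //; exists 1%N.
    by rewrite expr1 -ey epsB// !mul0mx.
  by have [j <-] := windowP iB; apply: hP; apply: map_f; rewrite mem_enum.
have [e0|e0] := pselect (forall i, e i = 0).
  left=> i; have [_ [q]] := eP i; rewrite e0 subr0 mulmx1 => yq.
  by exists q.
right.
have fh : gfamily A_ s s hy' by apply: gfamily_horner.
have e_idem : idempotent_factor B e.
  split=> [|//|i|].
  - rewrite (_ : e = (fun i => eps i *m (y i *m hy' i))).
      by apply: factors_mulr => //; apply: gfamily_mul fy fh.
    by apply/funext => i; rewrite mulmxA ey.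
  - by have [] := eP i.
  - by have /existsNP[i /eqP ei] := e0; exists i.
have e_eps i : e i *m eps i = e i by rewrite /e comm_yh -mulmxA ye.
have eps_e i : eps i *m e i = e i by rewrite /e mulmxA ey.
have eE i : e i = eps i.
  have [iB|iB] := ltnP B `|i|; first by rewrite e_out// epsB.
  (* The rank of e is at most that of eps in each degree; by minimality the totals agree, so they
     agree in each degree, and so do the images. *)
  have le_rk (j : 'I_(B.*2.+1)) : true ->
    (\rank (e (window j)) <= \rank (eps (window j))
       ?= iff (eps (window j) <= e (window j))%MS)%N.
    by move=> _; apply/mxrank_leqif_sup; rewrite -e_eps submxMl.
  have [le_t] := leqif_sum le_rk.
  rewrite eqn_leq le_t [X in X = _](eps_min e_idem) => /esym/forallP sub.
  have [j ji] := windowP iB; have := sub j; rewrite ji => /submxP[D eD].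
  by rewrite -eps_e eD -mulmxA (proj1 (eP i)).
exists (fun i => eps i *m (hy' i *m eps i)).
  split.
    apply: gfamily_mul (factors_gfamily epsF) _.
    exact: gfamily_mul fh (factors_gfamily epsF).
  by move=> i; rewrite addr0 mulmxA epsK -!mulmxA epsK.
move=> i; rewrite mulmxA ye mulmxA -/(e i) e_eps eE; split=> //.
by rewrite -!mulmxA ey -comm_yh -/(e i) eps_e eE.
Qed.

Let nilZ a y : nil y -> nil (fun i => a *: y i).
Proof. by move=> ny i; have [N yN] := ny i; exists N; rewrite exprZn yN scaler0. Qed.

(** The argument for local rings. If (y + y') w = eps, either y w is a unit, and y has a right
    inverse, or y w is nil, and a geometric series inverts y' w = eps - y w, so that y' has a right
    inverse. Nil elements have none. *)
Let nilD y y' : hom 0 y -> hom 0 y' -> nil y -> nil y' -> nil (fun i => y i + y' i).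
Proof.
move=> hy hy' ny ny'; have [//|[w hw yw]] := nil_or_unit (homD hy hy').
have hyw := hom0_mul hy hw; exfalso.
have [nyw|[z _ ywz]] := nil_or_unit hyw; last first.
  apply: (@no_right_inverse y (fun i => w i *m z i)) => // i.
  by rewrite mulmxA; have [] := ywz i.
have /choice[z zP] : forall i, exists z, y' i *m z = eps i.
  move=> i; have [N ywN] := nyw i.
  exists (w i *m \sum_(j < N) (y i *m w i) ^+ j).
  have [_ wi_eps] := hw; have [ew we] := wi_eps i; rewrite addr0 in we.
  have -> : y' i *m (w i *m \sum_(j < N) (y i *m w i) ^+ j) =
     (eps i - y i *m w i) *m \sum_(j < N) (y i *m w i) ^+ j.
    have [<- _] := yw i.
    by rewrite mulmxA [(_ + y' i) *m _]mulmxDl addrAC subrr add0r.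
  have -> : eps i - y i *m w i = eps i *m (1%:M - y i *m w i).
    by rewrite mulmxBr mulmx1 mulmxA; have [_ /(_ i) [-> _]] := hy.
  have := subrX1 (y i *m w i) N; rewrite ywN sub0r => /(congr1 -%R).
  rewrite opprK -mulNr opprB => E.
  by rewrite -mulmxA [X in eps i *m X](_ : _ = 1%:M) ?mulmx1// E.
exact: (@no_right_inverse y' z).
Qed.

Let nil_sum (I : Type) (t : seq I) (y : I -> int -> 'M[k]_d.+1) :
  (forall l, hom 0 (y l)) -> (forall l, nil (y l)) ->
  nil (fun i => \sum_(l <- t) y l i).
Proof.
move=> hy ny.
suff [] : hom 0 (fun i => \sum_(l <- t) y l i) /\
          nil (fun i => \sum_(l <- t) y l i) by [].
elim: t => [|l t [IHh IHn]].
  rewrite (_ : (fun _ => _) = (fun=> 0)); last first.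
    by apply/funext => i; rewrite big_nil.
  split=> [|i]; last by exists 1%N; rewrite expr1.
  by split=> [|i]; [apply: gfamily0|rewrite mulmx0 mul0mx].
rewrite (_ : (fun _ => _) = (fun i => y l i + \sum_(l <- t) y l i)).
  by split; [apply: homD|apply: nilD].
by apply/funext => i; rewrite big_cons.
Qed.

(** Otherwise the support of eps would be stable under adding c, but it is finite and non-empty. *)
Let nil_neq0 c y z : c != 0 -> hom c y -> ~ (forall i, y i *m z i = eps i).
Proof.
move=> c0 [_ hy] yz; have [_ _ _ [i0 i0P]] := eps_idem.
have step i : eps i != 0 -> eps (i + c) != 0.
  apply: contra_neq => e0; have [_ yi] := hy i.
  by rewrite -yz -yi e0 mulmx0 mul0mx.
have iterP n : eps (i0 + c *+ n) != 0.
  by elim: n => [|n IHn]; rewrite ?addr0// mulrSr addrA step.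
have /eqP[] := iterP (B + `|i0|).+1; apply: epsB.
by rewrite -mulr_natr; nia.
Qed.

(** The radical of the category with the degrees as objects and the homogeneous endomorphisms of N
    as morphisms. Nilness is imposed in degree 0 only: by [nil_neq0], maps of other degrees never
    have a right inverse. *)
Let radical (i j : 'I_(B.*2.+1)) : set 'M[k]_d.+1 :=
  [set x | exists y, [/\ hom (window j - window i) y,
                       window j - window i = 0 -> nil y
                       & x = y (window i)]].

Let radical_killed : exists q, forall i v, killed radical q i v.
Proof.
apply: nil_killed => [i j|i j l x x'|i x].
- split.
    exists (fun=> 0); split=> //; last by exists 1%N; rewrite expr1.
    by split=> [|l]; [apply: gfamily0|rewrite mulmx0 mul0mx].
  move=> a x x' [y [hy ny ->]] [y' [hy' ny' ->]].
  exists (fun l => a *: y l + y' l); split=> //.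
    by apply: homD => //; apply: homZ.
  move=> c0; move: hy hy'; rewrite c0 => hy hy'.
  by apply: nilD => //; [apply: homZ|apply: nilZ; apply: ny|apply: ny'].
- move=> [y [hy ny ->]] [y' [hy' ny' ->]].
  have := hom_mul hy hy'; rewrite addrC subrKA => hyy'.
  exists (fun l => y l *m y' (l + (window j - window i))); split=> //; last first.
    by rewrite addrC subrK.
  (* A composite of degree 0 that is not nil is a unit, and y gets a right inverse: impossible by
     [nil_neq0] if y has non-zero degree, and by nilness if it has degree 0. *)
  move=> c0; rewrite c0 in hyy'; have [//|[z _ yy'z]] := nil_or_unit hyy'.
  have yz i' : y i' *m (y' (i' + (window j - window i)) *m z i') = eps i'.
    by rewrite mulmxA; have [] := yy'z i'.
  have [c0'|/eqP c0'] := eqVneq (window j - window i) 0; last first.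
    by case: (nil_neq0 (introN eqP c0') hy yz).
  by rewrite c0' in hy yz; case: (no_right_inverse hy (ny c0') yz).
- by move=> [y [_ ny ->]]; apply: ny; rewrite subrr.
Qed.

Lemma minimal_graded_summand : exists q, graded_idempotents q /\ exists i, q i != 0.
Proof.
have [r [io [pi [sio spi epsE]]]] := epsF.
pose y l i := eps i *m io l i *m (pi l i *m eps i).
have hyl l : hom 0 (y l).
  have [fio bio] := sio l; split.
    apply: (@gfamily_mul _ _ _ _ _ s rho).
      by apply: gfamily_mul fio; apply: factors_gfamily epsF.
    by apply: gfamily_mul (spi l) _; apply: factors_gfamily epsF.
  by move=> i; rewrite addr0 /y !mulmxA epsK -!mulmxA epsK.
(* eps is the sum of the y l. Were they all nil, so would be the non-zero idempotent eps. *)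
have [l [g' hg' yg]] : exists l, exists2 z, hom 0 z &
    forall i, y l i *m z i = eps i /\ z i *m y l i = eps i.
  have [nl|/existsNP[l nl]] := pselect (forall l, nil (y l)); last first.
    by exists l; have [] := nil_or_unit (hyl l).
  have neps : nil eps.
    rewrite (_ : eps = (fun i => \sum_(l <- index_enum 'I_r) y l i)).
      exact: nil_sum.
    apply/funext => i; rewrite -[LHS]epsK -[X in X *m _]epsK {2}epsE.
    rewrite mulmx_sumr mulmx_suml; apply: eq_bigr => l _.
    by rewrite /y !mulmxA.
  by case: (no_left_inverse hom_eps neps (z := eps)).
(* Graded maps N -> M[t,1/t] -> N composing to the identity of N. *)
pose g i := eps i *m io l i.
pose psi i := pi l i *m eps i *m g' i.
have [fio _] := sio l.
have fg : gfamily A_ s rho g by apply: gfamily_mul fio; apply: factors_gfamily epsF.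
have fpsi : gfamily A_ rho s psi.
  apply: (@gfamily_mul _ _ _ _ _ rho s); last by case: hg'.
  by apply: gfamily_mul (spi l) _; apply: factors_gfamily epsF.
have gpsi i : g i *m psi i = eps i.
  by rewrite /psi mulmxA /g mulmxA -[X in X *m _]mulmxA;
  have [] := yg i; rewrite /y !mulmxA.
have epsg i : eps i *m g i = g i by rewrite /g mulmxA epsK.
have psieps i : psi i *m eps i = psi i.
  have [_ hg] := hg'; have [_] := hg i; rewrite addr0 => g'e.
  by rewrite /psi -mulmxA g'e.
have g_out i : (B < `|i|)%N -> g i = 0 by move=> iB; rewrite -epsg epsB ?mul0mx.
have psi_out i : (B < `|i|)%N -> psi i = 0.
  by move=> iB; rewrite -psieps epsB ?mulmx0.
have [q kq] := radical_killed.
(* T is the composite M -> N -> M at t = 1. The truncated geometric series hT inverts it on the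
   image of N, where (1 - T)^q vanishes ([gTq]). *)
pose T := \sum_(i < B.*2.+1) psi (window i) *m g (window i).
pose hT := \sum_(i < q) (1%:M - T) ^+ i.
have rad (i j : 'I_(B.*2.+1)) : i != j ->
    radical i j (g (window i) *m psi (window j)).
  move=> ij; exists (fun n => g n *m psi (n + (window j - window i))); split.
  - split; first by apply: (gfamily_mul fg); apply: gfamily_shift.
    by move=> n; rewrite mulmxA epsg -mulmxA psieps.
  - by move=> ji; case/eqP: ij; apply: ord_inj; move: ji; rewrite /window /=; lia.
  - by rewrite addrC subrK.
have gT (i : 'I_(B.*2.+1)) : g (window i) *m (1%:M - T) =
    - \sum_(j | j != i) g (window i) *m psi (window j) *m g (window j).
  rewrite mulmxBr mulmx1 mulmx_sumr (bigD1 i)//= mulmxA gpsi epsg.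
  rewrite opprD addrA subrr add0r; congr (- _).
  by apply: eq_bigr => j _; rewrite mulmxA.
(* Each factor 1 - T replaces g i by terms x g j with j != i and x in the radical; q such steps kill
   every vector. *)
have gTq (i : 'I_(B.*2.+1)) : g (window i) *m (1%:M - T) ^+ q = 0.
  apply/row_matrixP => a; rewrite row0 rowE mulmxA.
  have := kq i (delta_mx 0 a).
  elim: q {kq hT} i (delta_mx 0 a) => [|q' IHq] i v /=.
    by move=> ->; rewrite !mul0mx.
  move=> kv; rewrite exprS mulmxA -[v *m _ *m _]mulmxA gT mulmxN mulNmx.
  rewrite mulmx_sumr mulmx_suml big1 ?oppr0// => j ji.
  by rewrite mulmxA; apply: IHq; apply: kv; apply: rad; rewrite eq_sym.
have cTq i : comm_mx T ((1%:M - T) ^+ i).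
  elim: i => [|i IHi]; first by rewrite expr0; apply: comm_mx1.
  rewrite exprS; apply: comm_mxM => //.
  by apply: comm_mxB; [apply: comm_mx1|apply: comm_mx_refl].
have hTT : hT *m T = 1%:M - (1%:M - T) ^+ q.
  have -> : hT *m T = T *m hT by apply/esym/comm_mx_sum => i _; apply: cTq.
  have TE : T = - (1%:M - T - 1) by rewrite opprB subKr.
  rewrite [X in X *m _]TE mulNmx -[RHS]opprB; congr (- _).
  exact/esym/subrX1.
have gTT (i : 'I_(B.*2.+1)) : g (window i) *m hT *m T = g (window i).
  by rewrite -mulmxA hTT mulmxBr mulmx1 gTq subr0.
(* The defect of g i hT psi j from the identity of N. By [DE] it satisfies D = - D K, where K is the
   off-diagonal part of g psi; as K is radical, q iterations give D = 0. *)
pose D (i j : 'I_(B.*2.+1)) :=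
  g (window i) *m hT *m psi (window j) - (if i == j then eps (window i) else 0).
have sumD (i j : 'I_(B.*2.+1)) :
    \sum_l D i l *m (g (window l) *m psi (window j)) = 0.
  under eq_bigr do rewrite mulmxBl.
  rewrite sumrB [X in _ - X](bigD1 i)//= eqxx mulmxA epsg.
  rewrite [X in _ - (_ + X)]big1 ?addr0; last first.
    by move=> l'; rewrite eq_sym => /negPf ->; rewrite mul0mx.
  apply/eqP; rewrite subr_eq0 -[in X in _ == X]gTT; apply/eqP.
  rewrite -[RHS]mulmxA [T *m _]mulmx_suml [RHS]mulmx_sumr.
  by apply: eq_bigr => l' _; rewrite !mulmxA.
have DE (i j : 'I_(B.*2.+1)) :
    D i j = - \sum_(l | l != j) D i l *m (g (window l) *m psi (window j)).
  have Dj : D i j *m eps (window j) = D i j.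
    rewrite mulmxBl -[_ *m psi _ *m _]mulmxA psieps; congr (_ - _).
    by case: eqP => [->|]; rewrite ?epsK ?mul0mx.
  have := sumD i j; rewrite (bigD1 j)//= gpsi Dj => /eqP.
  by rewrite addr_eq0 => /eqP.
have D0 (i j : 'I_(B.*2.+1)) : D i j = 0.
  have kD r' : (r' <= q)%N -> forall j v, killed radical (q - r') j (v *m D i j).
    elim: r' => [|r' IHr] ltr {}j v; first by rewrite subn0.
    rewrite DE mulmxN mulmx_sumr -sumrN.
    under eq_bigr do rewrite -scaleN1r.
    rewrite big_mkcond; have [k0 kD] := killed_lin radical (q - r'.+1) j.
    elim/big_ind: _ => // [u v' ku kv|l' _]; first by rewrite -[u]scale1r; apply: kD.
    case: ifP => // lj; rewrite -[X in killed _ _ _ X]addr0; apply: kD => //.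
    have := IHr (ltnW ltr) l' v; rewrite -(subnSK ltr) /= => kl.
    by rewrite [v *m _]mulmxA; apply: kl; apply: rad.
  apply/row_matrixP => a; rewrite row0 rowE.
  by have := kD q (leqnn q) j (delta_mx 0 a); rewrite subnn.
have gpsi_delta i j : g i *m hT *m psi j = if i == j then eps i else 0.
  have [iB|iB] := ltnP B `|i|; first by rewrite g_out// epsB// !mul0mx if_same.
  have [jB|jB] := ltnP B `|j|.
    by rewrite psi_out// mulmx0; case: eqP => // ->; rewrite epsB.
  have [i' <-] := windowP iB; have [j' <-] := windowP jB.
  have /eqP := D0 i' j'; rewrite subr_eq0 => /eqP ->.
  by rewrite (inj_eq _)// => u v; rewrite /window => uv; apply: ord_inj; lia.
have commT n a : a \in A_ n -> rho a *m T = T *m rho a.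
  apply: (@gfamily_sum_comm _ (fun i => psi i *m g i)); first exact: gfamily_mul fg.
  by move=> i iB; rewrite psi_out ?mul0mx.
have commhT n a : a \in A_ n -> rho a *m hT = hT *m rho a.
  move=> An; apply: comm_mx_sum => i _.
  elim: (i : nat) => [|j IHj]; first by rewrite expr0; apply: comm_mx1.
  rewrite exprS; apply: comm_mxM => //.
  by apply: comm_mxB; [apply: comm_mx1|apply: commT An].
(* Orthogonality of these idempotents is [gpsi_delta]; they form a family because hT, like T,
   commutes with homogeneous elements. *)
exists (fun i => hT *m psi i *m g i); split; last first.
  have [_ _ _ [i epsi]] := eps_idem; exists i; apply: contra_neq epsi => q0.
  have gE : g i *m hT *m psi i = eps i by rewrite gpsi_delta eqxx.
  rewrite -epsK -gE.
  have -> : g i *m hT *m psi i *m (g i *m hT *m psi i) =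
      g i *m (hT *m psi i *m g i) *m (hT *m psi i) by rewrite !mulmxA.
  by rewrite q0 mulmx0 mul0mx.
split.
- move=> n a i An.
  rewrite -[hT *m _ *m _]mulmxA [LHS]mulmxA (commhT n)// -[LHS]mulmxA.
  by rewrite [rho a *m _]mulmxA fpsi// -[psi i *m _ *m _]mulmxA fg// !mulmxA.
- by exists B => i iB; rewrite g_out// mulmx0.
- move=> i j.
  have -> : hT *m psi i *m g i *m (hT *m psi j *m g j) =
      hT *m psi i *m (g i *m hT *m psi j) *m g j by rewrite !mulmxA.
  rewrite gpsi_delta; case: eqP => [->|_]; last by rewrite mulmx0 mul0mx.
  by rewrite -mulmxA epsg.
Qed.

End Minimal.

Hypothesis no_summand : forall q, graded_idempotents q -> forall i, q i = 0.

(** Otherwise the Fitting idempotents of th form an idempotent factor, non-zero in degree 0, and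
    [minimal_graded_summand] applies to one of least total rank within the same bound B. *)
Theorem factors_nil d (s : A -> 'M[k]_d) th : factors A_ rho s th ->
  exists N, th 0 ^+ N = 0.
Proof.
case: d s th => [|d] s th fth; first by exists 1%N; apply: flatmx0.
apply: contrapT => th_nil; have [B thB] := factors_bounded fth.
have ffth := factors_gfamily fth.
have [h hP] := fitting_poly [seq th (window i) | i : 'I_(B.*2.+1)].
pose e i := th i *m horner_mx (th i) h.
have e_out i : (B < `|i|)%N -> e i = 0 by move=> iB; rewrite /e thB// mul0mx.
have e_idem : idempotent_factor s B e.
  split=> // [|i|].
  - by apply: factors_mulr => //; apply: gfamily_horner.
  - have [iB|iB] := ltnP B `|i|; first by rewrite e_out// mulmx0.
    have [j <-] := windowP iB.
    by have [] := hP (th (window j)) (map_f _ (mem_enum _ j)).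
  - exists 0; apply: contra_notN th_nil => /eqP e0.
    have [j j0] := @windowP B 0 isT.
    have [_ [N]] := hP (th (window j)) (map_f _ (mem_enum _ j)).
    by rewrite j0 -/(e 0) e0 subr0 mulmx1 => thN; exists N.
pose P n := `[< exists e', idempotent_factor s B e' /\ total_rank B e' = n >].
have exP : exists n, P n by exists (total_rank B e); apply/asboolP; exists e.
case: (ex_minnP exP) => n /asboolP [eps [eps_idem eps_n]] minn.
have [e' e'_idem|q [qP [i]]] := minimal_graded_summand eps_idem.
  by rewrite eps_n; apply: minn; apply/asboolP; exists e'.
by rewrite no_summand// eqxx.
Qed.

(* Shifting the factors turns a sum over all degrees into a degree 0 component. *)
Lemma factors_trace d (s : A -> 'M[k]_d) (t : seq int)
    (io : int -> 'M[k]_(d, m)) (pi : int -> 'M[k]_(m, d)) :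
  gfamily A_ s rho io -> bounded io -> gfamily A_ rho s pi ->
  exists2 th, factors A_ rho s th & th 0 = \sum_(i <- t) io i *m pi i.
Proof.
move=> fio bio fpi.
exists (fun j => \sum_(i <- t) io (j + i) *m pi (j + i)); last first.
  by apply: eq_bigr => i _; rewrite add0r.
apply: factors_sum => i.
apply: (@factors_shift _ _ _ _ _ _ s i (fun j => io j *m pi j)).
exact: factors_pair.
Qed.

End GradedSummand.

(** * Gradings and representations *)

Section Components.
Variables (k : fieldType) (A : falgType k) (A_ : int -> {vspace A}).

Record components (D : nat) (c : int -> A -> A) : Prop := Components {
  comp_lin : forall n x a b, c n (x *: a + b) = x *: c n a + c n b;
  comp_mem : forall n a, c n a \in A_ n;
  comp_id : forall n a, a \in A_ n -> c n a = a;
  comp_neq : forall n m a, a \in A_ n -> m != n -> c m a = 0;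
  comp_out : forall (n : int) a, (D < `|n|)%N -> c n a = 0;
  comp_sum : forall a, a = \sum_(i < D.*2.+1) c (window i) a }.

Lemma grading_components : algebra_grading A_ -> exists D c, components D c.
Proof.
move=> [[_ dec uniq_dec] _].
pose N := \dim {:A}; pose e := vbasis {:A}.
have /choice[sf sfP] : forall j : 'I_N, exists sf : seq int * (int -> A),
    (forall n, sf.2 n \in A_ n) /\ e`_j = \sum_(n <- sf.1) sf.2 n.
  by move=> j; have [s [f [fA ->]]] := dec e`_j; exists (s, f).
(* The list of degrees may have repetitions, so terms of equal degree are collected. *)
pose F j n := \sum_(i <- (sf j).1 | i == n) (sf j).2 i.
have FA j n : F j n \in A_ n.
  by apply: memv_suml => i /eqP <-; have [] := sfP j.
pose D := (\max_(j < N) \max_(i <- (sf j).1) `|i|)%N.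
have leD j i : i \in (sf j).1 -> (`|i| <= D)%N.
  move=> ij; apply: leq_trans (leq_bigmax j).
  by rewrite (big_rem i)//= leq_maxl.
have eE (j : 'I_N) : e`_j = \sum_(i < D.*2.+1) F j (window i).
  have [_ ->] := sfP j; rewrite /F.
  under [RHS]eq_bigr do rewrite big_mkcond /=.
  rewrite exchange_big/=.
  rewrite [LHS]big_seq_cond [RHS]big_seq_cond; apply: eq_bigr => i.
  rewrite andbT => /leD/windowP[l <-].
  rewrite -big_mkcond (big_pred1 l)// => l'; rewrite /= eq_sym.
  by rewrite (inj_eq (@window_inj D)).
pose c n a := \sum_(j < N) coord e j a *: F j n.
have cA n a : c n a \in A_ n by apply: memv_suml => j _; rewrite memvZ.
have c_out (n : int) a : (D < `|n|)%N -> c n a = 0.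
  move=> nD; apply: big1 => j _; rewrite /F big1_seq ?scaler0// => i.
  by move=> /andP[/eqP -> /leD]; rewrite leqNgt nD.
have c_sum a : a = \sum_(i < D.*2.+1) c (window i) a.
  rewrite {1}(coord_vbasis (memvf a)) exchange_big/=; apply: eq_bigr => j _.
  by rewrite -scaler_sumr -eE.
have c_uniq n m a : a \in A_ n -> c m a = if m == n then a else 0.
  (* Uniqueness of decompositions is applied to the difference of two decompositions of a, over a
     window containing both supports. *)
  move=> an; pose f m' := c m' a - (if m' == n then a else 0).
  have [mB|mB] := leqP `|m| (D + `|n|)%N; last first.
    rewrite c_out; last by lia.
    by case: eqP mB => // ->; lia.
  pose t := [seq window i | i : 'I_((D + `|n|).*2.+1)].
  have ut : uniq t by rewrite map_inj_uniq ?enum_uniq//; apply: window_inj.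
  have tP i : (`|i| <= D + `|n|)%N -> i \in t.
    by move=> /windowP[j <-]; apply: map_f; rewrite mem_enum.
  suff fm : f m = 0 by apply/eqP; rewrite -subr_eq0 -/(f m) fm.
  apply: (uniq_dec t f ut) (tP m mB) => [m'|].
    by rewrite /= rpredB//; case: eqP => [->//|_]; rewrite mem0v.
  rewrite sumrB -(sum_window (B := D) (f := fun i => c i a) ut).
  - rewrite -c_sum (big_rem n)/= ?eqxx; last by apply: tP; lia.
    rewrite big1_seq ?addr0 ?subrr// => i; rewrite mem_rem_uniq// inE.
    by move=> /andP[_ /andP[/negPf ->]].
  - move=> i; apply: contra_neqT => /negP it; apply: c_out.
    by rewrite ltnNge; apply/negP => iD; apply/it/tP; lia.
  - by move=> i /c_out.
exists D, c; split=> //.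
- move=> n x a b; rewrite /c scaler_sumr -big_split/=; apply: eq_bigr => j _.
  by rewrite linearP scalerDl scalerA.
- by move=> n a an; rewrite (c_uniq n)// eqxx.
- by move=> n m a an /negPf mn; rewrite (c_uniq n)// mn.
Qed.

Section ComponentTheory.
Hypothesis A_grading : algebra_grading A_.
Variables (D : nat) (c : int -> A -> A).
Hypothesis cP : components D c.

Lemma comp0 n : c n 0 = 0.
Proof. 
have := comp_lin cP n 1 0 0; rewrite !scale1r addr0 => E.
by apply: (addrI (c n 0)); rewrite addr0 -E.
Qed.

Lemma compD n a b : c n (a + b) = c n a + c n b.
Proof. by have := comp_lin cP n 1 a b; rewrite !scale1r. Qed.

Lemma comp_raddf_sum n (I : Type) (t : seq I) (f : I -> A) :
  c n (\sum_(i <- t) f i) = \sum_(i <- t) c n (f i).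
Proof.
elim: t => [|i t IHt]; first by rewrite !big_nil comp0.
by rewrite !big_cons compD IHt.
Qed.

(** Comparing parts of degree n in a = a 1 shows that a = a (c 0 1) for homogeneous a; summing this
    over the components of 1 gives c 0 1 = 1. *)
Lemma mem_grading1 : 1 \in A_ 0.
Proof.
have homr n a : a \in A_ n -> a * c 0 1 = a.
  move=> an; have [_ gM] := A_grading.
  have -> : a * c 0 1 = c n (a * c 0 1).
    by apply/esym/(comp_id cP); rewrite -[n]addr0 gM// (comp_mem cP).
  rewrite -[RHS](comp_id cP an).
  have -> : c n a = \sum_(j < D.*2.+1) c n (a * c (window j) 1).
    by rewrite -comp_raddf_sum -mulr_sumr -(comp_sum cP) mulr1.
  have [j0 j0E] := @windowP D 0 isT.
  rewrite (bigD1 j0)//= j0E big1 ?addr0//.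
  move=> j jj0; apply: (comp_neq cP (n := n + window j)).
    by rewrite gM// (comp_mem cP).
  rewrite -[X in X != _]addr0 (inj_eq (addrI n)) -j0E (inj_eq (@window_inj D)).
  by rewrite eq_sym.
suff <- : c 0 1 = 1 by apply: comp_mem cP _ _.
rewrite -[LHS]mul1r [X in X * _](comp_sum cP) mulr_suml.
rewrite [RHS](comp_sum cP); apply: eq_bigr => j _.
exact/homr/(comp_mem cP).
Qed.

End ComponentTheory.
End Components.

Record right_action (A : pzRingType) (V : zmodType) (act : V -> A -> V) : Prop :=
  RightAction {
    act_addl : forall a x y, act (x + y) a = act x a + act y a;
    act_addr : forall x a b, act x (a + b) = act x a + act x b;
    act_1 : forall x, act x 1 = x;
    act_mul : forall x a b, act x (a * b) = act (act x a) b }.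

Definition action_module (A : pzRingType) (V : zmodType) (act : V -> A -> V)
  (actP : right_action act) : Type := V.

Section ActionModule.
Variables (A : pzRingType) (V : zmodType) (act : V -> A -> V).
Variable actP : right_action act.
Local Notation M := (action_module actP).

HB.instance Definition _ := GRing.Zmodule.on M.

Definition action_scale (a : A^c) (x : M) : M := act x a.

Fact action_scaleA (a b : A^c) x :
  action_scale a (action_scale b x) = action_scale (a * b) x.
Proof. exact/esym/(act_mul actP). Qed.
Fact action_scale1 : left_id 1 action_scale.
Proof. exact: (act_1 actP). Qed.
Fact action_scaleDr : right_distributive action_scale +%R.
Proof. by move=> a x y; apply: (act_addl actP). Qed.
Fact action_scaleDl x : {morph action_scale^~ x : a b / a + b}.
Proof. by move=> a b; apply: (act_addr actP). Qed.

HB.instance Definition _ := GRing.Zmodule_isLmodule.Build A^c M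
  action_scaleA action_scale1 action_scaleDr action_scaleDl.

Lemma ractE (x : M) a : ract x a = act x a. Proof. by []. Qed.

End ActionModule.

Section RightModuleTheory.
Variables (A : pzRingType) (M N : rmodType A).

Lemma ractDl (x y : M) a : ract (x + y) a = ract x a + ract y a.
Proof. exact: scalerDr. Qed.

Lemma ractDr (x : M) a b : ract x (a + b) = ract x a + ract x b.
Proof. exact: scalerDl. Qed.

Lemma ractM (x : M) a b : ract x (a * b) = ract (ract x a) b.
Proof. exact/esym/(@scalerA A^c). Qed.

Lemma ract1 (x : M) : ract x 1 = x.
Proof. exact: scale1r. Qed.

Lemma ract_suml (I : Type) (t : seq I) (f : I -> M) a :
  ract (\sum_(i <- t) f i) a = \sum_(i <- t) ract (f i) a.
Proof. exact: scaler_sumr. Qed.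

Lemma ract_sumr (I : Type) (t : seq I) (f : I -> A) (x : M) :
  ract x (\sum_(i <- t) f i) = \sum_(i <- t) ract x (f i).
Proof. exact: scaler_suml. Qed.

Lemma linear_ract (f : {linear M -> N}) x a : f (ract x a) = ract (f x) a.
Proof. exact: linearZ. Qed.

Lemma ract_linear (f : M -> N) : (forall x y, f (x + y) = f x + f y) ->
  (forall x a, f (ract x a) = ract (f x) a) -> linear f.
Proof. by move=> fD fZ a x y; rewrite fD [f (a *: x)](fZ x a). Qed.

End RightModuleTheory.

Section Representations.
Variables (k : fieldType) (A : falgType k).

Record representation d (s : A -> 'M[k]_d) : Prop := Representation {
  rep_lin : forall c a b, s (c *: a + b) = c *: s a + s b;
  rep_1 : s 1 = 1%:M;
  rep_mul : forall a b, s (a * b) = s a *m s b }.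

(** M in coordinates. The field acts on M through A, which makes f k-linear when s is a
    representation ([carried_scale]). *)
Definition carried_by (M : rmodType A) d (s : A -> 'M[k]_d) (f : 'rV[k]_d -> M) :=
  [/\ bijective f, forall x y, f (x + y) = f x + f y
    & forall x a, f (x *m s a) = ract (f x) a].

Section RepresentationTheory.
Variables (d : nat) (s : A -> 'M[k]_d).
Hypothesis sP : representation s.

Lemma rep0 : s 0 = 0.
Proof.
have := rep_lin sP 1 0 0; rewrite !scale1r addr0 => E.
by apply: (addrI (s 0)); rewrite addr0 -E.
Qed.

Lemma repZ c a : s (c *: a) = c *: s a.
Proof. by have := rep_lin sP c a 0; rewrite rep0 !addr0. Qed.

Lemma repD a b : s (a + b) = s a + s b.
Proof. by have := rep_lin sP 1 a b; rewrite !scale1r. Qed.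

Lemma rep_sum (I : Type) (t : seq I) (f : I -> A) :
  s (\sum_(i <- t) f i) = \sum_(i <- t) s (f i).
Proof.
elim: t => [|i t IHt]; first by rewrite !big_nil rep0.
by rewrite !big_cons repD IHt.
Qed.

Lemma rep_scalar c : s (c%:A) = c%:M.
Proof. by rewrite repZ (rep_1 sP) scalemx1. Qed.

Lemma rep_right_action : right_action (fun (x : 'rV[k]_d) a => x *m s a).
Proof.
split=> [a x y|x a b|x|x a b].
- exact: mulmxDl.
- by rewrite repD mulmxDr.
- by rewrite (rep_1 sP) mulmx1.
- by rewrite (rep_mul sP) mulmxA.
Qed.

Lemma carried_scale (M : rmodType A) (f : 'rV[k]_d -> M) c x :
  carried_by s f -> f (c *: x) = ract (f x) c%:A.
Proof. by move=> [_ _ <-]; rewrite rep_scalar mul_mx_scalar. Qed.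

End RepresentationTheory.

Lemma fg_carried (M : rmodType A) : finitely_generated M ->
  exists d (s : A -> 'M[k]_d) (f : 'rV[k]_d -> M), representation s /\ carried_by s f.
Proof.
move=> [n [g gP]].
pose sc (c : k) (x : M) := ract x c%:A.
have scD c x y : sc c (x + y) = sc c x + sc c y by apply: ractDl.
have scDl c c' x : sc (c + c') x = sc c x + sc c' x.
  by rewrite /sc scalerDl ractDr.
have scA c c' x : sc c (sc c' x) = sc (c * c') x.
  by rewrite /sc -ractM mulr_algl scalerA mulrC.
have sc1 x : sc 1 x = x by rewrite /sc scale1r ract1.
have sc_ract c x a : ract (sc c x) a = sc c (ract x a).
  by rewrite /sc -!ractM mulr_algl mulr_algr.
have sc_suml I (t : seq I) (f : I -> k) x :
    sc (\sum_(i <- t) f i) x = \sum_(i <- t) sc (f i) x.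
  by rewrite /sc scaler_suml ract_sumr.
have sc_sumr I (t : seq I) (f : I -> M) c :
    sc c (\sum_(i <- t) f i) = \sum_(i <- t) sc c (f i).
  by rewrite /sc ract_suml.
pose span N (b : 'I_N -> M) := forall x, exists c : 'rV[k]_N,
  x = \sum_i sc (c 0 i) (b i).
pose P N := `[< exists b : 'I_N -> M, span N b >].
have exP : exists N, P N.
  pose T := ('I_n * 'I_(\dim {:A}))%type; pose e := vbasis {:A}.
  pose h (l : 'I_#|{: T}|) : T := enum_val l.
  exists #|{: T}|; apply/asboolP.
  exists (fun l => ract (g (h l).1) e`_((h l).2)) => x.
  have [a ->] := gP x.
  exists (\row_l coord e (h l).2 (a (h l).1)).
  transitivity (\sum_(l : T) sc (coord e l.2 (a l.1)) (ract (g l.1) e`_(l.2))).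
    rewrite -(pair_bigA _ (fun i j => sc (coord e j (a i)) (ract (g i) e`_j)))/=.
    apply: eq_bigr => i _; rewrite -/(ract (g i) (a i)).
    rewrite {1}(coord_vbasis (memvf (a i))) ract_sumr; apply: eq_bigr => j _.
    by rewrite /sc -ractM mulr_algr.
  rewrite (reindex h)/=; last by apply: onW_bij; apply: enum_val_bij.
  by apply: eq_bigr => l _; rewrite mxE.
case: (ex_minnP exP) => d /asboolP[b bP] mind.
pose f (x : 'rV[k]_d) := \sum_i sc (x 0 i) (b i).
have fD x y : f (x + y) = f x + f y.
  by rewrite /f -big_split/=; apply: eq_bigr => i _; rewrite mxE scDl.
have fZ c x : f (c *: x) = sc c (f x).
  by rewrite /f sc_sumr; apply: eq_bigr => i _; rewrite mxE scA.
have fN x : f (- x) = - f x.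
  by apply: (addrI (f x)); rewrite -fD !subrr /f big1// => i _; rewrite mxE /sc
    scale0r /ract scale0r.
have f0 x : f x = 0 -> x = 0.
  move=> fx0; apply/rowP => i0; rewrite mxE; apply/eqP/negPn/negP => xi0.
  have [d' dE] : exists d', d = d'.+1.
    by exists d.-1; rewrite prednK//; apply: leq_ltn_trans (ltn_ord i0).
  subst d.
  have /mind : P d'; last by rewrite ltnn.
  apply/asboolP; exists (b \o lift i0) => y; have [c ->] := bP y.
  pose c' := c - (c 0 i0 / x 0 i0) *: x.
  exists (\row_j c' 0 (lift i0 j)); rewrite -/(f c).
  have -> : f c = f c' by rewrite /c' fD fN fZ fx0 /sc /ract scaler0 subr0.
  rewrite /f (bigD1_ord i0)//=.
  have -> : c' 0 i0 = 0 by rewrite !mxE divfK ?subrr.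
  rewrite /sc scale0r {1}/ract scale0r add0r.
  by apply: eq_bigr => j _; rewrite mxE.
have f_inj : injective f.
  by move=> x y xy; apply/subr0_eq/f0; rewrite fD fN xy subrr.
have /choice[h fh] : forall y, exists x, f x = y.
  by move=> y; have [x ->] := bP y; exists x.
have hf : cancel f h by move=> x; apply: f_inj; rewrite fh.
have f_bij : bijective f by exists h.
pose s a : 'M[k]_d := \matrix_i h (ract (f (delta_mx 0 i)) a).
have f_sum I (t : seq I) (u : I -> 'rV[k]_d) :
    f (\sum_(i <- t) u i) = \sum_(i <- t) f (u i).
  elim: t => [|i t IHt]; last by rewrite !big_cons fD IHt.
  by rewrite !big_nil; apply: (addrI (f 0)); rewrite -fD !addr0.
have fs x a : f (x *m s a) = ract (f x) a.
  rewrite mulmx_sum_row f_sum [in RHS](row_sum_delta x) f_sum ract_suml.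
  by apply: eq_bigr => i _; rewrite !fZ rowK fh sc_ract.
have sE (m m' : 'M[k]_d) : (forall x, f (x *m m) = f (x *m m')) -> m = m'.
  by move=> mm'; apply/row_matrixP => i; rewrite !rowE; apply: f_inj.
exists d, s, f; split=> //; split=> [c a b'||a b']; apply: sE => x.
- rewrite fs mulmxDr fD -scalemxAr fZ !fs ractDr; congr (_ + _).
  by rewrite /sc -ractM mulr_algr.
- by rewrite fs ract1 mulmx1.
- by rewrite mulmxA !fs ractM.
Qed.

End Representations.

Section Gradability.
Variables (k : fieldType) (A : falgType k) (A_ : int -> {vspace A}).

Lemma idempotents_gradable (M : rmodType A) d (s : A -> 'M[k]_d)
    (f : 'rV[k]_d -> M) (q : int -> 'M[k]_d) B :
  representation s -> carried_by s f -> graded_idempotents A_ s q ->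
  bounded_by B q -> \sum_(i < B.*2.+1) q (window i) = 1%:M -> gradable A_ M.
Proof.
move=> sP [[g fg gf] fD fs] [fq _ qq] qB q1.
pose N : rmodType A := action_module (rep_right_action sP).
pose C (n : int) : set N := [set x | (x : 'rV[k]_d) *m q n = x]%classic.
have dirC : direct_sum_decomposition C.
  split=> [n|v|t u ut Cu sum0 n nt].
  - split=> [|x y]; rewrite !inE /C /=; first by rewrite mul0mx.
    by move=> xq yq; rewrite [LHS]mulmxBl xq yq.
  - exists [seq window i | i : 'I_(B.*2.+1)], (fun n => (v : 'rV[k]_d) *m q n).
    split=> [n|]; first by rewrite /C /= -mulmxA qq eqxx.
    by rewrite big_map big_enum -[LHS](mulmx1 (v : 'rV[k]_d)) -q1 mulmx_sumr.
  - have := congr1 (fun x : 'rV[k]_d => x *m q n) sum0.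
    rewrite /= mul0mx => <-; rewrite [RHS]mulmx_suml (big_rem n)//= Cu.
    rewrite [X in _ + X]big1_seq ?addr0// => i; rewrite mem_rem_uniq// inE.
    by move=> /andP[_ /andP[/negPf ni _]]; rewrite -(Cu i) -mulmxA qq ni mulmx0.
have C_ract i j x a : C i x -> a \in A_ j -> C (i + j) (ract x a).
  by rewrite /C /= ractE => xq aA; rewrite -mulmxA fq// mulmxA xq.
exists (GradedRmodule dirC C_ract).
have gD x y : g (x + y) = g x + g y.
  by apply: (can_inj fg); rewrite gf fD !gf.
have gs x a : g (ract x a) = ract (g x : N) a.
  by apply: (can_inj fg); rewrite gf [f _]fs gf.
pose gL := GRing.isLinear.Build A^c M N _ g (@ract_linear A M N g gD gs).
pose G : {linear M -> N} := HB.pack g gL.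
by exists G; exists f.
Qed.

(** Split off a gradable summand of largest rank, with projection E. Its complement is non-zero, and
    any gradable summand of the complement could be added to it. *)
Lemma ungradable_part (D : nat) (c : int -> A -> A) d (s : A -> 'M[k]_d) :
  components A_ D c -> representation s ->
  ~ (exists q B, [/\ graded_idempotents A_ s q, bounded_by B q
        & \sum_(i < B.*2.+1) q (window i) = 1%:M]) ->
  exists m (rho : A -> 'M[k]_m), [/\ representation rho, (0 < m)%N
    & forall q, graded_idempotents A_ rho q -> forall i, q i = 0].
Proof.
move=> cP sP nq.
pose P n := `[< exists q B, [/\ graded_idempotents A_ s q, bounded_by B q
  & \rank (\sum_(i < B.*2.+1) q (window i))%R = n] >].
have exP : exists n, P n.
  exists 0%N; apply/asboolP; exists (fun=> 0), 0%N; split=> //; last first.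
    by rewrite big1 ?mxrank0.
  split=> [||i j]; [exact: gfamily0|by exists 0%N|].
  by rewrite mulmx0 if_same.
have ubP n : P n -> (n <= d)%N.
  by move=> /asboolP[q [B [_ _ <-]]]; apply: rank_leq_row.
case: (ex_maxnP exP ubP) => n /asboolP[q [B [[fq bq qq] qB]]].
set E := (X in \rank X) => rkE maxn.
have qE i : q i *m E = q i.
  have [iB|iB] := ltnP B `|i|; first by rewrite qB// mul0mx.
  have [j <-] := windowP iB; rewrite /E mulmx_sumr (bigD1 j)//= qq eqxx.
  rewrite big1 ?addr0// => l lj; rewrite qq (inj_eq (@window_inj B)) eq_sym.
  by rewrite (negPf lj).
have Eq i : E *m q i = q i.
  have [iB|iB] := ltnP B `|i|; first by rewrite qB// mulmx0.
  have [j <-] := windowP iB; rewrite /E mulmx_suml (bigD1 j)//= qq eqxx.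
  by rewrite big1 ?addr0// => l lj; rewrite qq (inj_eq (@window_inj B)) (negPf lj).
have EE : E *m E = E by rewrite {2}/E mulmx_sumr; apply: eq_bigr => i _.
have sE a : s a *m E = E *m s a.
  rewrite (comp_sum cP a) rep_sum// mulmx_suml mulmx_sumr.
  apply: eq_bigr => i _.
  exact: (gfamily_sum_comm fq qB (comp_mem cP (window i) a)).
pose e := 1%:M - E.
have ee : e *m e = e.
  by rewrite mulmxBr mulmx1 mulmxBl mul1mx EE subrr subr0.
have se a : s a *m e = e *m s a.
  by rewrite mulmxBr mulmxBl mulmx1 mul1mx sE.
have e0 : e != 0.
  apply: contra_notN nq; rewrite subr_eq0 => /eqP E1.
  by exists q, B; split.
(* Coordinates on the image of e: R is the inclusion and C the projection of a rank
   factorization. *)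
have [r [R [C [CR RC r0]]]] : exists r (R : 'M[k]_(r, d)) (C : 'M[k]_(d, r)),
    [/\ C *m R = e, R *m C = 1%:M & (0 < r)%N].
  exists (\rank e), (row_base e), (col_base e); split.
  - exact: mulmx_base.
  - apply: (row_full_inj (col_base_full e)).
    apply: (row_free_inj (row_base_free e)).
    by rewrite /= mulmx1 mulmxA -(mulmxA (_ *m _)) !mulmx_base ee.
  - by rewrite lt0n mxrank_eq0.
have Re : R *m e = R by rewrite -CR mulmxA RC mul1mx.
have eC : e *m C = C by rewrite -CR -mulmxA RC mulmx1.
pose rho a := R *m s a *m C.
have sC a : s a *m C = C *m rho a.
  by rewrite /rho !mulmxA CR -se -mulmxA eC.
have Rs a : R *m s a = rho a *m R.
  by rewrite /rho -mulmxA CR -mulmxA se mulmxA Re.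
exists r, rho; split=> //.
- split=> [x a b||a b].
  + by rewrite /rho (rep_lin sP) mulmxDr mulmxDl -scalemxAr -scalemxAl.
  + by rewrite /rho (rep_1 sP) mulmx1.
  + by rewrite {1}/rho (rep_mul sP) [R *m _]mulmxA Rs -!(mulmxA (rho a)).
move=> q' [fq' [B' q'B'] qq'].
have eE : e *m E = 0 by rewrite mulmxBl mul1mx EE subrr.
have Ee : E *m e = 0 by rewrite mulmxBr mulmx1 EE subrr.
have qC i : q i *m C = 0.
  by rewrite -eC mulmxA -qE -[_ *m E *m e]mulmxA Ee mulmx0 mul0mx.
have Rq i : R *m q i = 0 by rewrite -Re -mulmxA -Eq [e *m _]mulmxA eE mul0mx mulmx0.
pose q2 i := q i + C *m q' i *m R.
have q2P : graded_idempotents A_ s q2.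
  split.
  - move=> j a i aA; rewrite mulmxDr mulmxDl fq//; congr (_ + _).
    by rewrite !mulmxA sC -(mulmxA C (rho a)) fq'// -[RHS]mulmxA Rs !mulmxA.
  - exists (B + B')%N => i iB; rewrite /q2 qB ?q'B' ?mulmx0 ?mul0mx ?addr0//; lia.
  - move=> i j; rewrite mulmxDl !mulmxDr qq !mulmxA qC !mul0mx addr0.
    rewrite -[X in _ + (X + _)]mulmxA Rq mulmx0 add0r.
    rewrite -[C *m _ *m R *m C]mulmxA RC mulmx1 -[C *m _ *m _]mulmxA qq'.
    by case: eqP => // _; rewrite mulmx0 mul0mx addr0.
have q2B : bounded_by (B + B') q2.
  by move=> i iB; rewrite /q2 qB ?q'B' ?mulmx0 ?mul0mx ?addr0//; lia.
pose F' := \sum_(i < (B + B').*2.+1) q' (window i).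
have E2 : \sum_(i < (B + B').*2.+1) q2 (window i) = E + C *m F' *m R.
  rewrite big_split/= mulmx_sumr mulmx_suml; congr (_ + _).
  pose t := [seq window i | i : 'I_((B + B').*2.+1)].
  rewrite [RHS](sum_window (t := t)).
  - by rewrite big_map big_enum.
  - by rewrite map_inj_uniq ?enum_uniq//; apply: window_inj.
  - move=> i qi; have [|j <-] := @windowP (B + B') i.
      by apply: contra_neqT qi; rewrite -ltnNge => iB; apply: qB; lia.
    by apply: map_f; rewrite mem_enum.
  - exact: qB.
pose F := C *m F' *m R.
have EF : E *m F = 0 by rewrite /F -eC !mulmxA Ee !mul0mx.
have FE : F *m E = 0 by rewrite /F -Re -!mulmxA eE !mulmx0.
have F'q' i : F' *m q' i = q' i.
  have [iB|iB] := ltnP (B + B') `|i|; first by rewrite q'B' ?mulmx0//; lia.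
  have [j <-] := windowP iB; rewrite /F' mulmx_suml (bigD1 j)//= qq' eqxx.
  rewrite big1 ?addr0// => l lj.
  by rewrite qq' (inj_eq (@window_inj (B + B')))(negPf lj).
have F'F' : F' *m F' = F' by rewrite {2}/F' mulmx_sumr; apply: eq_bigr => i _.
have FF : F *m F = F.
  by rewrite /F -!mulmxA [R *m _]mulmxA RC mul1mx [F' *m (F' *m _)]mulmxA F'F'.
(* E and F are orthogonal idempotents. By maximality E + F has the rank of E, hence the same row
   space, which forces F = 0. *)
have F0 : F = 0.
  have sub : (E <= (E + F)%R)%MS.
    by apply/submxP; exists E; rewrite mulmxDr EE EF addr0.
  have [le_rk] := mxrank_leqif_sup sub.
  have -> : \rank E = \rank (E + F)%R.
    apply/eqP; rewrite eqn_leq le_rk rkE; apply: maxn; apply/asboolP.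
    by exists q2, (B + B')%N; split=> //; rewrite E2.
  rewrite eqxx => /esym/submxP[X EX].
  have FX : F *m (E + F) = F by rewrite mulmxDr FE FF add0r.
  by rewrite -[LHS]FF -{1}FX EX -!mulmxA EF !mulmx0.
have F'0 : F' = 0.
  rewrite -[F']mul1mx -RC -[LHS]mulmx1 -RC.
  have -> : R *m C *m F' *m (R *m C) = R *m F *m C by rewrite /F !mulmxA.
  by rewrite F0 mulmx0 mul0mx.
by move=> i; rewrite -F'q' F'0 mul0mx.
Qed.

End Gradability.

(** * Composition series and endofinite modules *)

Section ChainUnion.
Local Open Scope classical_set_scope.
Local Open Scope ring_scope.

(** Zorn's lemma will also be fed the empty chain, with empty union. D, the diagonal or the zero
    submodule below, is adjoined to every set so that this case is admissible. *)
Lemma total_bigcup_finite (T : Type) (F : set (set T)) (D : set T) (I : eqType)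
    (s : seq I) (w : I -> T) :
  total_on F subset ->
  (forall i, i \in s -> (\bigcup_(X in F) X `|` D) (w i)) ->
  (forall i, i \in s -> D (w i)) \/
  exists2 X, F X & forall i, i \in s -> (X `|` D) (w i).
Proof.
move=> totF; elim: s => [|i s IHs] wF; first by left.
have [j js|sD|[X FX sX]] := IHs; first by apply: wF; rewrite inE js orbT.
- have [[X FX Xwi]|Dwi] := wF i (mem_head _ _); last first.
    by left=> j; rewrite inE => /orP[/eqP ->//|/sD].
  right; exists X => // j; rewrite inE => /orP[/eqP ->|/sD]; first by left.
  by right.
- right; have [[Y FY Ywi]|Dwi] := wF i (mem_head _ _); last first.
    by exists X => // j; rewrite inE => /orP[/eqP ->|/sX//]; right.
  have [XY|YX] := totF _ _ FX FY.
    exists Y => // j; rewrite inE => /orP[/eqP ->|/sX]; first by left.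
    by case=> [/XY|]; [left|right].
  exists X => // j; rewrite inE => /orP[/eqP ->|/sX//].
  by left; apply: YX.
Qed.

End ChainUnion.

Section FiniteLength.
Local Open Scope classical_set_scope.
Local Open Scope ring_scope.
Variables (R : pzRingType) (M : lmodType R).

(** A non-simple interval is cut at an intermediate submodule, and both halves have a smaller
    difference of ranks. *)
Lemma rank_finite_length (S : set M) (rk : set M -> nat) :
  (forall T T' : set M, submod_closed [in T] -> submod_closed [in T'] ->
     T `<` T' -> T' `<=` S -> (rk T < rk T')%N) ->
  submod_closed [in S] -> finite_length_sub S.
Proof.
move=> rk_lt Scl.
pose chain (T T' : set M) := exists (n : nat) (C : nat -> set M),
  [/\ C 0%N = T, C n = T', (forall i, (i <= n)%N -> submod_closed [in C i])
    & forall i, (i < n)%N -> simple_factor (C i) (C i.+1)].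
suff chains N : forall T T', submod_closed [in T] -> submod_closed [in T'] ->
    T `<=` T' -> T' `<=` S -> (rk T' - rk T < N)%N -> chain T T'.
  apply: (chains (rk S - rk [set 0]).+1) => //.
    split=> [|a x y]; rewrite !inE//= => -> ->.
    by rewrite scaler0 addr0.
  by move=> _ ->; have [] := Scl; rewrite inE.
elim: N => // N IHN T T' Tcl Tcl' sTT' sT'S; rewrite ltnS => leN.
have [->|neqTT'] := pselect (T = T').
  by exists 0%N, (fun=> T'); split.
have ltTT' : T `<` T'.
  by split=> // sT'T; apply: neqTT'; apply/seteqP.
have [simpleT|] := pselect (simple_factor T T').
  exists 1%N, (fun i => if i is 0%N then T else T'); split=> //.
    by move=> [|i].
  by move=> [|i].
move=> /not_andP[//|/existsNP[U /not_implyP[Ucl]]].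
move=> /not_implyP[sTU /not_implyP[sUT' /not_orP[neqUT neqUT']]].
have ltTU : T `<` U by split=> // sUT; apply: neqUT; apply/seteqP.
have ltUT' : U `<` T' by split=> // sT'U; apply: neqUT'; apply/seteqP.
have rkTU := rk_lt _ _ Tcl Ucl ltTU (subset_trans sUT' sT'S).
have rkUT' := rk_lt _ _ Ucl Tcl' ltUT' sT'S.
have [|n1 [C1 [C10 C1n C1cl C1s]]] := IHN T U Tcl Ucl sTU (subset_trans sUT' sT'S).
  by lia.
have [|n2 [C2 [C20 C2n C2cl C2s]]] := IHN U T' Ucl Tcl' sUT' sT'S.
  by lia.
exists (n1 + n2)%N, (fun i => if (i <= n1)%N then C1 i else C2 (i - n1)%N); split.
- by rewrite leq0n.
- case: leqP => [le|_]; last by rewrite addKn.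
  have n20 : n2 = 0%N by lia.
  by rewrite n20 addn0 C1n -C20 -C2n n20.
- by move=> i le; case: leqP => lei; [apply: C1cl|apply: C2cl; lia].
- move=> i lti; have [lei|lei|lei] := ltngtP i n1.
  + by apply: C1s.
  + by rewrite subSn 1?ltnW//; apply: C2s; lia.
  + by rewrite lei C1n -C20 subSnn; apply: C2s; lia.
Qed.

Lemma finite_length_fg : finite_length M -> finitely_generated M.
Proof.
move=> [n [C [C0 Cn Ccl Cs]]].
have /(_ n (leqnn n)) [m [g gP]] : forall i, (i <= n)%N ->
    exists m (g : 'I_m -> M), forall x, C i x ->
      exists a : 'I_m -> R, x = \sum_l a l *: g l.
  elim=> [|i IHi] lei.
    exists 0%N, (fun=> 0) => x; rewrite C0 => ->.
    by exists (fun=> 0); rewrite big_ord0.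
  have [m [g gP]] := IHi (ltnW lei).
  have [[sC nsC] simC] := Cs i lei.
  have /existsNP[x /not_implyP[Cx nCx]] := nsC.
  exists m.+1, (fun l => oapp g x (unlift ord0 l)) => y Cy.
  (* U is C i + R x; simplicity of the factor identifies it with C i.+1. *)
  pose U : set M := [set z | exists a, C i (z - a *: x)].
  have [C0' CD] := Ccl i (ltnW lei); have [_ CD'] := Ccl i.+1 lei.
  rewrite inE in C0'.
  have cD a u v : C i u -> C i v -> C i (a *: u + v).
    by move=> Cu Cv; have := CD a u v; rewrite !inE; apply.
  have cD' a u v : C i.+1 u -> C i.+1 v -> C i.+1 (a *: u + v).
    by move=> Cu Cv; have := CD' a u v; rewrite !inE; apply.
  have [|||UC|UC] := simC U.
  - split; first by rewrite inE; exists 0; rewrite scale0r subr0.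
    move=> c u v; rewrite !inE => -[a Ca] [b Cb]; exists (c * a + b).
    have -> : c *: u + v - (c * a + b) *: x = c *: (u - a *: x) + (v - b *: x).
      by rewrite scalerBr scalerDl scalerA opprD addrACA.
    exact: cD.
  - by move=> z Cz; exists 0; rewrite scale0r subr0.
  - move=> z [a Ca].
    by rewrite -[z](subrK (a *: x)) addrC; apply: cD' => //; apply: sC.
  - exfalso; apply: nCx; rewrite -UC; exists 1.
    by rewrite scale1r subrr.
  - have : U y by rewrite UC.
    move=> [a /gP[b yE]]; exists (fun l => oapp b a (unlift ord0 l)).
    rewrite big_ord_recl unlift_none/=.
    under eq_bigr do rewrite liftK/=.
    by rewrite -yE addrC subrK.
by exists m, g => x; apply: gP; rewrite Cn.
Qed.

End FiniteLength.

(** * Retractions in modules of finite endolength *)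

Section EndoRanked.
Local Open Scope classical_set_scope.
Local Open Scope ring_scope.
Variables (R : pzRingType) (Q : lmodType R).

Definition endo_stable (S : set Q) :=
  [/\ S 0, forall x y, S x -> S y -> S (x + y)
    & forall (f : {linear Q -> Q}) x, S x -> S (f x)].

(* Finite length over the endomorphism ring, in the form of a rank function. *)
Definition endo_ranked := exists rk : set Q -> nat,
  forall S T, endo_stable S -> endo_stable T -> S `<` T -> (rk S < rk T)%N.

(* y_i |-> z_i extends to a linear map from the span of the y_i. *)
Definition extends (I : finType) (y z : I -> Q) :=
  forall a : I -> R, \sum_i a i *: y i = 0 -> \sum_i a i *: z i = 0.

Definition sumf (T I J : Type) (f : I -> T) (g : J -> T) (s : I + J) : T :=
  match s with inl i => f i | inr j => g j end.

Section Extends.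
Variables (I J : finType).
Implicit Types y z : I -> Q.

Lemma extends_linear y z (f : {linear Q -> Q}) :
  extends y z -> extends y (fun i => f (z i)).
Proof.
move=> yz a /yz E.
transitivity (f (\sum_i a i *: z i)); last by rewrite E linear0.
rewrite linear_sum; by apply: eq_bigr => i _; rewrite linearZ.
Qed.

Lemma extends0 y : extends y (fun=> 0).
Proof. by move=> a _; rewrite big1// => i _; rewrite scaler0. Qed.

Lemma extendsD y z z' : extends y z -> extends y z' ->
  extends y (fun i => z i + z' i).
Proof.
move=> yz yz' a ya.
under eq_bigr do rewrite scalerDr.
by rewrite big_split/= yz// yz'// addr0.
Qed.

Lemma extendsB y z z' : extends y z -> extends y z' ->
  extends y (fun i => z i - z' i).
Proof.
move=> yz yz'; apply: extendsD => // a ya.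
under eq_bigr do rewrite scalerN.
by rewrite sumrN yz' ?oppr0.
Qed.

Lemma extends_trans y z z' : extends y z -> extends z z' -> extends y z'.
Proof. by move=> yz zz' a /yz/zz'. Qed.

Lemma extends_reindex (h : J -> I) y z :
  extends y z -> extends (fun j => y (h j)) (fun j => z (h j)).
Proof.
move=> yz a.
have sumE (t : I -> Q) :
    \sum_j a j *: t (h j) = \sum_i (\sum_(j | h j == i) a j) *: t i.
  rewrite (partition_big h xpredT)//=; apply: eq_bigr => i _.
  by rewrite scaler_suml; apply: eq_bigr => j /eqP <-.
by rewrite !sumE; apply: yz.
Qed.

End Extends.

(** A retraction onto U for each finite family, with no compatibility between families; being a
    finitary condition, it passes to unions of chains. *)
Definition locally_split (U : set Q) := forall (I : finType) (y : I -> Q),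
  exists z, [/\ extends y z, forall i, U (z i) & forall i, U (y i) -> z i = y i].

Lemma image_locally_split (e : {linear Q -> Q}) (U : set Q) :
  (forall x, U (e x)) -> (forall x, U x -> e x = x) -> locally_split U.
Proof.
move=> eU Ue I y; exists (fun i => e (y i)); split=> // [|i /Ue//].
exact: (extends_linear e (z := y)).
Qed.

Section Retraction.
Variable U : set Q.
Hypothesis U_sub : U 0 /\ forall a x y, U x -> U y -> U (a *: x + y).
Hypothesis U_split : locally_split U.

Let U0 : U 0. Proof. by have [] := U_sub. Qed.
Let UB x y : U x -> U y -> U (x - y).
Proof.
move=> Ux Uy; have [_ UD] := U_sub.
by rewrite addrC -scaleN1r; apply: UD.
Qed.

Let diag : set (Q * Q) := [set w | U w.1 /\ w.2 = w.1].

(* The pairs of G define a map with values in U that extends to every finite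
   set, i.e. it preserves pp-types. *)
Let good (G : set (Q * Q)) :=
  forall (I : finType) (w : I -> Q * Q), (forall i, G (w i)) ->
  forall (J : finType) (y : J -> Q), exists2 z : J -> Q, (forall j, U (z j)) &
    extends (sumf (fun i => (w i).1) y) (sumf (fun i => (w i).2) z).

Let good_diag : good diag.
Proof.
move=> I w wd J y.
have [z [yz Uz zU]] := U_split (sumf (fun i => (w i).1) y).
exists (fun j => z (inr j)) => [j|]; first exact: Uz.
suff -> : sumf (fun i => (w i).2) (fun j => z (inr j)) = z by [].
apply/funext => -[i|j]//=; by have [Uw ->] := wd i; rewrite zU.
Qed.

Let good_linear G x y t u v r a : good G -> G (x, u) -> G (y, v) -> G (t, r) ->
  t = a *: x + y -> r = a *: u + v.
Proof.
move=> gG Gx Gy Gt tE.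
pose w (i : option bool) :=
  if i is Some b then if b then (x, u) else (y, v) else (t, r).
have Gw i : G (w i) by case: i => [[]|].
have [z _ /extends_reindex-/(_ _ inl) wz] := gG _ w Gw void (fun=> 0).
pose c (i : option bool) : R :=
  if i is Some b then if b then - a else - 1 else 1.
have sumE (f : option bool -> Q) :
    \sum_i c i *: f i = f None - (a *: f (Some true) + f (Some false)).
  rewrite (bigD1 None)//= (bigD1 (Some true))//= (bigD1 (Some false))//=.
  rewrite big1 ?addr0 => [|[[]|]//].
  by rewrite scale1r scaleN1r scaleNr -opprD.
have := wz c; rewrite !sumE /= tE subrr => /(_ erefl)/eqP.
by rewrite subr_eq0 => /eqP.
Qed.

(** Adding x itself as an extra element forces its value to be u, and that value lies in U. *)
Let good_range G x u : good G -> G (x, u) -> U u.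
Proof.
move=> gG Gx; have [z Uz wz] := gG unit (fun=> (x, u)) (fun=> Gx) unit (fun=> x).
have := wz (sumf (fun=> 1) (fun=> - 1)).
have sum_unit (f : unit -> Q) : \sum_i f i = f tt.
  by rewrite (big_pred1 tt) => // -[].
rewrite !big_sumType/= !sum_unit !scale1r !scaleN1r subrr.
by move=> /(_ erefl)/eqP; rewrite subr_eq0 => /eqP ->; apply: Uz.
Qed.

Section Extension.
Variable G : set (Q * Q).
Hypothesis G_good : good G.
Hypothesis G0 : G (0, 0).
Variable rk : set Q -> nat.
Hypothesis rk_lt :
  forall S T, endo_stable S -> endo_stable T -> S `<` T -> (rk S < rk T)%N.
Variable q : Q.

Let ocons (T J : Type) (x : T) (f : J -> T) (o : option J) : T :=
  if o is Some j then f j else x.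

(** The possible differences between two images of q that are compatible with the data w and y. *)
Let ambiguity (I J : finType) (w : I -> Q * Q) (y : J -> Q) : set Q :=
  [set v | exists z : J -> Q,
     extends (ocons q (sumf (fun i => (w i).1) y)) (ocons v (sumf (fun=> 0) z))].

Let ambiguity_stable (I J : finType) (w : I -> Q * Q) (y : J -> Q) :
  endo_stable (ambiguity w y).
Proof.
split=> [|v v' [z vz] [z' vz']|f v [z vz]].
- exists (fun=> 0); have := @extends0 _ (ocons q (sumf (fun i => (w i).1) y)).
  by congr (extends _ _); apply/funext => -[[]|].
- exists (fun j => z j + z' j); have := extendsD vz vz'.
  by congr (extends _ _); apply/funext => -[[i|j]|]//=; rewrite addr0.
- exists (fun j => f (z j)); have := extends_linear f vz.
  by congr (extends _ _); apply/funext => -[[i|j]|]//=; rewrite linear0.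
Qed.

(** Take data w0, y0 of least ambiguity and the image of q that they provide. Further data cannot
    reduce the ambiguity, so a solution for them can be corrected until q has that same image. This
    is the proof that finite endolength implies pure-injectivity. *)
Lemma good_extension : exists u, good (G `|` [set (q, u)]).
Proof.
pose P n := `[< exists (I J : finType) (w : I -> Q * Q) (y : J -> Q),
  (forall i, G (w i)) /\ rk (ambiguity w y) = n >].
have exP : exists n, P n.
  exists (rk (@ambiguity unit unit (fun=> (0, 0)) (fun=> 0))); apply/asboolP.
  by exists unit, unit, (fun=> (0, 0)), (fun=> 0).
case: (ex_minnP exP) => n /asboolP[I0 [J0 [w0 [y0 [Gw0 <-]]]]] minn.
have [z0 Uz0 wz0] := G_good Gw0 (ocons q y0).
exists (z0 None) => I w Gw J y.
(* A pair of w outside G is (q, u) itself and is handled at the position of q; (0, 0) is mere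
   padding. *)
pose w' i := if `[< G (w i) >] then w i else (0, 0).
have Gw' i : G (w' i) by rewrite /w'; case: ifP => // /asboolP.
pose w1 := sumf w0 w'; pose y1 := sumf y0 y.
have Gw1 i : G (w1 i) by case: i.
have [z1 Uz1 wz1] := G_good Gw1 (ocons q y1).
pose v := z1 None - z0 None.
have v_amb : ambiguity w0 y0 v.
  exists (fun j => z1 (Some (inl j)) - z0 (Some j)).
  pose h1 (o : option (I0 + J0)) : (I0 + I) + option (J0 + J) :=
    match o with
    | None => inr None | Some (inl i) => inl (inl i)
    | Some (inr j) => inr (Some (inl j)) end.
  pose h0 (o : option (I0 + J0)) : I0 + option J0 :=
    match o with
    | None => inr None | Some (inl i) => inl i
    | Some (inr j) => inr (Some j) end.
  have e1 := extends_reindex (h := h1) wz1; have e0 := extends_reindex (h := h0) wz0.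
  have yE : (fun o => sumf (fun i => (w0 i).1) (ocons q y0) (h0 o)) =
      ocons q (sumf (fun i => (w0 i).1) y0) by apply/funext => -[[i|j]|].
  have yE1 : (fun o => sumf (fun i => (w1 i).1) (ocons q y1) (h1 o)) =
      ocons q (sumf (fun i => (w0 i).1) y0) by apply/funext => -[[i|j]|].
  rewrite yE1 in e1; rewrite yE in e0; have := extendsB e1 e0.
  congr (extends _ _); apply/funext => -[[i|j]|]//=.
  by rewrite subrr.
have amb_sub : ambiguity w1 y1 `<=` ambiguity w0 y0.
  move=> u [z uz]; exists (fun j => z (inl j)).
  pose h (o : option (I0 + J0)) : option ((I0 + I) + (J0 + J)) :=
    match o with
    | None => None | Some (inl i) => Some (inl (inl i))
    | Some (inr j) => Some (inr (inl j)) end.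
  have := extends_reindex (h := h) uz.
  by congr (extends _ _); apply/funext => -[[i|j]|].
have v_amb1 : ambiguity w1 y1 v.
  apply: contrapT => nv.
  have := @rk_lt _ _ (ambiguity_stable w1 y1) (ambiguity_stable w0 y0).
  rewrite ltnNge minn; last first.
    by apply/asboolP; exists (I0 + I)%type, (J0 + J)%type, w1, y1.
  by move=> E; suff : ~~ true by []; apply: E; split=> // /(_ _ v_amb).
have Uv : U v by apply: UB.
have [z2 wz2] := v_amb1.
(* The correction z2 may leave U; a local retraction moves it into U and fixes v and 0, which are
   already there. *)
have [z3 [wz3 Uz3 z3U]] := U_split (ocons v (sumf (fun _ : (I0 + I)%type => 0) z2)).
exists (fun j => z1 (Some (inr j)) - z3 (Some (inr (inr j)))) => [j|].
  exact: UB.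
have wz := extends_trans wz2 wz3.
pose h1 (s : I + J) : (I0 + I) + option (J0 + J) :=
  match s with
  | inl i => if `[< G (w i) >] then inl (inr i) else inr None
  | inr j => inr (Some (inr j)) end.
pose h2 (s : I + J) : option ((I0 + I) + (J0 + J)) :=
  match s with
  | inl i => if `[< G (w i) >] then Some (inl (inr i)) else None
  | inr j => Some (inr (inr j)) end.
have e1 := extends_reindex (h := h1) wz1; have e2 := extends_reindex (h := h2) wz.
have yE1 : (fun o => sumf (fun i => (w1 i).1) (ocons q y1) (h1 o)) =
    sumf (fun i => (w i).1) y.
  apply/funext => -[i|j]//=; case: asboolP => /= Gwi.
    by rewrite /w'; case: asboolP.
  by have [//|] := Gw i; move=> ->.
have yE2 : (fun o => ocons q (sumf (fun i => (w1 i).1) y1) (h2 o)) =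
    sumf (fun i => (w i).1) y.
  apply/funext => -[i|j]//=; case: asboolP => /= Gwi.
    by rewrite /w'; case: asboolP.
  by have [//|] := Gw i; move=> ->.
rewrite yE1 in e1; rewrite yE2 in e2; have := extendsB e1 e2.
congr (extends _ _); apply/funext => -[i|j]//=; case: asboolP => /= Gwi.
  rewrite z3U//= subr0 /w'; by case: asboolP.
rewrite z3U//= /v subKr.
by have [//|] := Gw i; move=> ->.
Qed.

End Extension.

(** A maximal good set, with the diagonal adjoined, is the graph of the retraction: [good_extension]
    makes it total and [good_linear] makes it linear. *)
Lemma locally_split_retract : endo_ranked ->
  exists e : {linear Q -> Q}, (forall x, U (e x)) /\ forall x, U x -> e x = x.
Proof.
move=> [rk rk_lt].
have [F totF|G [gG maxG]] :=
  @Zorn_bigcup (Q * Q)%type (fun G => good (G `|` diag)).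
  move=> gF I w wF J y.
  have [i _|wd|[X FX wX]] := total_bigcup_finite gF (D := diag)
    (s := enum I) (w := w); first exact: wF.
    by apply: good_diag => i; apply: wd; rewrite mem_enum.
  by apply: (totF _ FX) => i; apply: wX; rewrite mem_enum.
pose G' := G `|` diag.
have G'U x : U x -> G' (x, x) by move=> Ux; right.
have /choice[e eP] : forall q, exists u, G' (q, u).
  move=> q; have [u gu] := good_extension gG (G'U 0 U0) rk_lt q.
  exists u; have [Gqu|nGqu] := pselect (G (q, u)); first by left.
  exfalso; apply: (maxG (G `|` [set (q, u)])); last by rewrite setUAC.
  by split=> [x Gx|sub]; [left|apply: nGqu; apply: sub; right].
have eL : linear e.
  by move=> a x y; apply: (good_linear gG (eP x) (eP y) (eP (a *: x + y))).
pose eM := GRing.isLinear.Build R Q Q _ e eL.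
pose E : {linear Q -> Q} := HB.pack e eM.
exists E; split=> [x|x Ux]; first exact: good_range gG (eP x).
have := good_linear gG (G'U x Ux) (G'U 0 U0) (eP x) (a := 1).
by rewrite scale1r addr0; apply.
Qed.

End Retraction.
End EndoRanked.

Section FixedPoints.
Local Open Scope classical_set_scope.
Local Open Scope ring_scope.
Variables (R : pzRingType) (Q : lmodType R) (e : {linear Q -> Q}).

Definition fixed_pred : {pred Q} := fun x => e x == x.

Fact fixed_submod_closed : submod_closed fixed_pred.
Proof.
split=> [|a x y]; rewrite !unfold_in ?linear0//.
by move=> /eqP ex /eqP ey; rewrite linearP ex ey.
Qed.

HB.instance Definition _ :=
  GRing.isSubmodClosed.Build R Q fixed_pred fixed_submod_closed.

Record fixed_points := FixedPoint {
  fixed_val :> Q;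
  _ : fixed_val \in fixed_pred }.

HB.instance Definition _ := [isSub for fixed_val].
HB.instance Definition _ := [Choice of fixed_points by <:].
HB.instance Definition _ := [SubChoice_isSubLmodule of fixed_points by <:].

End FixedPoints.

Section Summands.
Local Open Scope classical_set_scope.
Local Open Scope ring_scope.
Variables (R : pzRingType) (Q : lmodType R).

Definition summand (G : lmodType R) := exists (i : {linear G -> Q})
  (p : {linear Q -> G}), cancel i p.

Lemma fixed_points_summand (e : {linear Q -> Q}) : (forall x, e (e x) = e x) ->
  exists (i : {linear fixed_points e -> Q}) (p : {linear Q -> fixed_points e}),
    cancel i p /\ forall x, i (p x) = e x.
Proof.
move=> ee; have efix x : e x \in fixed_pred e by rewrite unfold_in ee.
pose i : {linear fixed_points e -> Q} := val.
pose p x : fixed_points e := FixedPoint (efix x).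
have pL : linear p by move=> a x y; apply: val_inj; rewrite /= linearP.
pose pM := GRing.isLinear.Build R Q (fixed_points e) _ p pL.
pose P : {linear Q -> fixed_points e} := HB.pack p pM.
exists i, P; split=> // x; apply: val_inj => /=.
by have := valP x; rewrite unfold_in => /eqP.
Qed.

(** C generates an endomorphism-stable subgroup of Q under all maps G -> Q, and is recovered from it
    along i, so the rank stays strictly monotone. *)
Lemma summand_endo_ranked (G : lmodType R) :
  summand G -> endo_ranked Q -> endo_ranked G.
Proof.
move=> [i [p ip]] [rk rk_lt].
pose ext (C : set G) : set Q := [set x | exists n (f : 'I_n -> {linear G -> Q})
  (c : 'I_n -> G), (forall l, C (c l)) /\ x = \sum_l f l (c l)].
have ext_stable C : endo_stable (ext C).
  split=> [|x y [n [f [c [Cc ->]]]] [n' [f' [c' [Cc' ->]]]]|g x [n [f [c [Cc ->]]]]].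
  - exists 0%N, (fun=> i), (fun=> 0); split=> [[]//|].
    by rewrite big_ord0.
  - exists (n + n')%N,
      (fun l => match fintype.split l with inl l => f l | inr l => f' l end),
      (fun l => match fintype.split l with inl l => c l | inr l => c' l end).
    split=> [l|]; first by case: fintype.split.
    rewrite big_split_ord/=; congr (_ + _); apply: eq_bigr => l _.
      by rewrite (unsplitK (inl l)).
    by rewrite (unsplitK (inr l)).
  - exists n, (fun l => g \o f l), c; split=> //.
    by rewrite linear_sum.
have extP C : endo_stable C -> forall x, C x <-> ext C (i x).
  move=> [C0 CD Cf] x; split=> [Cx|[n [f [c [Cc /(congr1 p)]]]]].
    by exists 1%N, (fun=> i), (fun=> x); rewrite big_ord1.
  rewrite ip linear_sum => ->; elim/big_ind: _ => // l _.
  exact: (Cf (p \o f l)).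
exists (fun C => rk (ext C)) => S T Sst Tst [sST nsTS].
apply: rk_lt => //; split=> [x [n [f [c [Sc ->]]]]|sub].
  by exists n, f, c; split=> // l; apply: sST.
by apply: nsTS => x /(extP T Tst)/sub/(extP S Sst).
Qed.

End Summands.

(** * Existence of indecomposable summands *)

Section IndecomposableSummand.
Local Open Scope classical_set_scope.
Local Open Scope ring_scope.
Variables (R : pzRingType) (Q : lmodType R).
Hypothesis Q_ranked : endo_ranked Q.

Let submod (U : set Q) := U 0 /\ forall a x y, U x -> U y -> U (a *: x + y).

Lemma maximal_split (x0 : Q) : x0 != 0 -> exists U : set Q,
  [/\ submod U, locally_split U, ~ U x0
    & forall V, submod V -> locally_split V -> ~ V x0 -> U `<=` V -> V `<=` U].
Proof.
move=> x00; pose P (U : set Q) := [/\ submod (U `|` [set 0]),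
  locally_split (U `|` [set 0]) & ~ (U `|` [set 0]) x0].
have [F FP totF|U [[Us Usp Ux0] maxU]] := @Zorn_bigcup Q P.
  have pick (I : finType) (w : I -> Q) (t : seq I) :
      (forall i, i \in t -> (\bigcup_(X in F) X `|` [set 0]) (w i)) ->
      exists U : set Q, [/\ submod U, locally_split U,
        U `<=` \bigcup_(X in F) X `|` [set 0] & forall i, i \in t -> U (w i)].
    move=> wF; have [w0|[X FX Xw]] := total_bigcup_finite totF wF.
      exists [set 0]; split=> [|J y|x ->|//]; last by right.
        by split=> [|a x y /= -> ->]; rewrite /= ?scaler0 ?addr0.
      exists (fun=> 0); split=> [a _|//|j /= ->//].
      by rewrite big1// => i _; rewrite scaler0.
    have [Xs Xsp _] := FP _ FX; exists (X `|` [set 0]); split=> //.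
    by move=> x [Xx|->]; [left; exists X|right].
  split.
  - split=> [|a x y Fx Fy]; first by right.
    have [|U [[U0 UD] _ UF Uxy]] :=
      @pick bool (fun b => if b then x else y) [:: true; false].
      by move=> [].
    apply: UF; apply: UD.
      by apply: (Uxy true).
    by apply: (Uxy false).
  - move=> I y.
    pose t := [seq i <- enum I | `[< (\bigcup_(X in F) X `|` [set 0]) (y i) >]].
    have [i|U [_ Usp UF Ut]] := @pick I y t.
      by rewrite mem_filter => /andP[/asboolP].
    have [z [yz Uz zU]] := Usp I y; exists z; split=> // [i|i Fyi].
      exact/UF/Uz.
    apply: zU; apply: Ut; rewrite mem_filter mem_enum andbT.
    exact/asboolP.
  - move=> [[X FX Xx0]|/= x00']; last by rewrite x00' eqxx in x00.
    by have [_ _ []] := FP _ FX; left.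
exists (U `|` [set 0]); split=> // V Vs Vsp Vx0 sUV.
apply: contrapT => nVU; apply: (maxU V).
  split=> [x Ux|sVU]; first by apply: sUV; left.
  by apply: nVU => x /sVU; left.
have V0 : V `|` [set 0] = V.
  by apply/seteqP; split=> x; [case=> // ->; case: Vs|left].
by rewrite /P V0.
Qed.

(** G is a complement of a maximal U. If G = N1 + N2 with both non-zero, then U + N1 and U + N2 are
    summands larger than U, so both contain x0. The part of x0 in G then lies in N1 and in N2, hence
    is 0, and x0 is in U. *)
Lemma indecomposable_summand : nonzero Q ->
  exists2 G : lmodType R, summand Q G & indecomposable G.
Proof.
move=> [x0 x00]; have [U [Us Usp Ux0 maxU]] := maximal_split x00.
have [r [rU Ur]] := locally_split_retract Us Usp Q_ranked.
have rr x : r (r x) = r x by apply: Ur.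
pose e : {linear Q -> Q} := idfun \- r.
have eE x : e x = x - r x by [].
have ee x : e (e x) = e x by rewrite !eE linearB rr subrr subr0.
have re x : r (e x) = 0 by rewrite eE linearB rr subrr.
have [i [p [ip ep]]] := fixed_points_summand ee.
have ri y : r (i y) = 0 by rewrite -[y]ip ep re.
have pr x : p (r x) = 0.
  by apply: (can_inj ip); rewrite ep eE rr subrr linear0.
exists (fixed_points e); first by exists i, p.
split.
  exists (p x0); apply: contra_notN Ux0 => /eqP px0.
  have : e x0 = 0 by rewrite -ep px0 linear0.
  by rewrite eE => /subr0_eq ->; apply: rU.
move=> N1 N2 [f [g fg gf]] [[n1 n10] [n2 n20]].
have gL : linear g.
  by move=> a x y; apply: (can_inj fg); rewrite gf linearP !gf.
pose gM := GRing.isLinear.Build R (N1 * N2)%type (fixed_points e) _ g gL.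
pose G : {linear (N1 * N2)%type -> fixed_points e} := HB.pack g gM.
have part (s : {linear (N1 * N2)%type -> (N1 * N2)%type}) :
    (forall n, s (s n) = s n) -> (exists n, s n != 0) -> e x0 = i (g (s (f (p x0)))).
  move=> ss [n sn].
  pose c : {linear Q -> Q} := r \+ (i \o G \o s \o f \o p).
  have cE x : c x = r x + i (g (s (f (p x)))) by [].
  have cc x : c (c x) = c x.
    have rc : r (c x) = r x by rewrite cE linearD rr ri addr0.
    have pc : p (c x) = g (s (f (p x))) by rewrite cE linearD pr add0r ip.
    by rewrite [LHS]cE rc pc gf ss -cE.
  pose V := [set x | c x = x].
  have Vs : submod V.
    split=> [|a x y]; first exact: linear0.
    move=> cx cy; apply: (etrans (linearP c a x y)).
    by rewrite (cx : c x = x) (cy : c y = y).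
  have Vsp : locally_split V by apply: (@image_locally_split _ _ c).
  have sUV : U `<=` V.
    move=> x Ux; suff : c x = x by [].
    have px : p x = 0 by rewrite -[x]Ur// pr.
    by rewrite cE px !linear0 (linear0 G : g 0 = 0) linear0 addr0 Ur.
  have Vx0 : V x0.
    apply: contrapT => nV; have := maxU V Vs Vsp nV sUV (i (g (s n))).
    have Vi : V (i (g (s n))).
      suff : c (i (g (s n))) = i (g (s n)) by [].
      by rewrite cE ri add0r ip gf ss.
    move=> /(_ Vi)/Ur; rewrite ri => /esym i0; have : g (s n) = 0.
      by rewrite -[g (s n)]ip i0 linear0.
    move=> /(congr1 f); rewrite gf linear0 => sn0.
    by rewrite sn0 eqxx in sn.
  by rewrite eE -{1}Vx0 cE addrC addKr.
have [s1 s1E] : exists s : {linear (N1 * N2)%type -> (N1 * N2)%type},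
    forall n, s n = (n.1, 0).
  pose h (n : (N1 * N2)%type) : (N1 * N2)%type := (n.1, 0).
  have hL : linear h.
    move=> a x y; rewrite /h.
    by rewrite [RHS](_ : _ = (a *: x.1 + y.1, a *: 0 + 0))// scaler0 addr0.
  pose hM := GRing.isLinear.Build R (N1 * N2)%type (N1 * N2)%type _ h hL.
  pose s : {linear (N1 * N2)%type -> (N1 * N2)%type} := HB.pack h hM.
  by exists s.
have [s2 s2E] : exists s : {linear (N1 * N2)%type -> (N1 * N2)%type},
    forall n, s n = (0, n.2).
  pose h (n : (N1 * N2)%type) : (N1 * N2)%type := (0, n.2).
  have hL : linear h.
    move=> a x y; rewrite /h.
    by rewrite [RHS](_ : _ = (a *: 0 + 0, a *: x.2 + y.2))// scaler0 addr0.
  pose hM := GRing.isLinear.Build R (N1 * N2)%type (N1 * N2)%type _ h hL.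
  pose s : {linear (N1 * N2)%type -> (N1 * N2)%type} := HB.pack h hM.
  by exists s.
have E1 : e x0 = i (g ((f (p x0)).1, 0)).
  rewrite -s1E; apply: part => [n|]; first by rewrite !s1E.
  by exists (n1, 0); rewrite s1E; apply: contra_neq n10 => -[].
have E2 : e x0 = i (g (0, (f (p x0)).2)).
  rewrite -s2E; apply: part => [n|]; first by rewrite !s2E.
  by exists (0, n2); rewrite s2E; apply: contra_neq n20 => -[].
have : (f (p x0)).1 = 0.
  have : g ((f (p x0)).1, 0) = g (0, (f (p x0)).2).
    by apply: (can_inj ip); rewrite -E1 -E2.
  by move=> /(can_inj gf)[].
move=> f10; have ex0 : e x0 = 0 by rewrite E1 f10 (linear0 G : g (0, 0) = 0) linear0.
by apply: Ux0; move: ex0; rewrite eE => /subr0_eq ->; apply: rU.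
Qed.

Lemma endo_ranked_finite_length (G : lmodType R) :
  endo_ranked G -> finite_length (endomod G : lmodType (endo G)).
Proof.
move=> [rk rk_lt].
have stable (S : set (endomod G)) : submod_closed [in S] -> endo_stable (S : set G).
  move=> [S0 SD]; rewrite inE in S0; split=> // [x y Sx Sy|f x Sx].
    by have := SD 1 x y; rewrite !inE scale1r; apply.
  by have := SD (f : endo G) x 0; rewrite !inE addr0; apply.
apply: (@rank_finite_length (endo G) (endomod G : lmodType (endo G)) setT
  (rk : set (endomod G) -> nat)) => [T T' Tcl Tcl' ltT _|].
  by apply: rk_lt => //; apply: stable.
by split=> [|a x y]; rewrite !inE.
Qed.

End IndecomposableSummand.

(** * Twisted modules *)

Section LinearToMatrix.
Variables (F : fieldType) (m n : nat) (phi : 'rV[F]_m -> 'rV[F]_n).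
Hypothesis phiD : forall x y, phi (x + y) = phi x + phi y.
Hypothesis phiZ : forall c x, phi (c *: x) = c *: phi x.

Definition matrix_of : 'M[F]_(m, n) := \matrix_l phi (delta_mx 0 l).

Lemma mul_matrix_of x : x *m matrix_of = phi x.
Proof.
have phi0 : phi 0 = 0 by rewrite -(scale0r 0) phiZ scale0r.
rewrite mulmx_sum_row [in RHS](row_sum_delta x).
rewrite (big_morph phi phiD phi0); apply: eq_bigr => l _.
by rewrite rowK phiZ.
Qed.

End LinearToMatrix.

Section Twist.
Variables (k : fieldType) (A : falgType k) (A_ : int -> {vspace A}).
Hypothesis A_grading : algebra_grading A_.
Variables (D : nat) (c : int -> A -> A).
Hypothesis cP : components A_ D c.

Section TwistedAction.
Variables (V : zmodType) (act : V -> A -> V) (tau : int -> V -> V).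
Hypothesis actP : right_action act.
Hypothesis tau_add : forall n x y, tau n (x + y) = tau n x + tau n y.
Hypothesis tau_0 : forall x, tau 0 x = x.
Hypothesis tauD : forall i j x, tau (i + j) x = tau i (tau j x).
Hypothesis tau_act : forall n x a, tau n (act x a) = act (tau n x) a.

(** tau n plays the role of multiplication by t^n. *)
Definition twist (x : V) (a : A) : V :=
  \sum_(i < D.*2.+1) tau (window i) (act x (c (window i) a)).

Let tau0 n : tau n 0 = 0.
Proof. by apply: (addrI (tau n 0)); rewrite -tau_add !addr0. Qed.

Let act0 x : act x 0 = 0.
Proof. by apply: (addrI (act x 0)); rewrite -(act_addr actP) !addr0. Qed.

Lemma twist_hom n x a : a \in A_ n -> twist x a = tau n (act x a).
Proof.
move=> an; have [nD|nD] := ltnP D `|n|.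
  have a0 : a = 0 by rewrite -(comp_id cP an) (comp_out cP).
  rewrite a0 act0 tau0 /twist big1// => i _.
  by rewrite (comp0 cP) act0 tau0.
have [j jn] := windowP nD; rewrite /twist (bigD1 j)//= jn (comp_id cP)//.
rewrite big1 ?addr0// => i ij; rewrite (comp_neq cP an) ?act0//.
by rewrite -jn (inj_eq (@window_inj D)).
Qed.

Lemma twist_addl x y a : twist (x + y) a = twist x a + twist y a.
Proof.
rewrite /twist -big_split/=; apply: eq_bigr => i _.
by rewrite (act_addl actP) tau_add.
Qed.

Lemma twist_addr x a b : twist x (a + b) = twist x a + twist x b.
Proof.
rewrite /twist -big_split/=; apply: eq_bigr => i _.
by rewrite (compD cP) (act_addr actP) tau_add.
Qed.

Let twist_sumr (I : Type) (t : seq I) (f : I -> A) x :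
  twist x (\sum_(i <- t) f i) = \sum_(i <- t) twist x (f i).
Proof.
apply: (big_morph (twist x) (twist_addr x)).
by rewrite /twist big1// => i _; rewrite (comp0 cP) act0 tau0.
Qed.

Let twist_suml (I : Type) (t : seq I) (f : I -> V) a :
  twist (\sum_(i <- t) f i) a = \sum_(i <- t) twist (f i) a.
Proof.
apply: (big_morph (twist^~ a) (fun x y => twist_addl x y a)).
rewrite /twist big1// => i _.
have -> : act 0 (c (window i) a) = 0; last by rewrite tau0.
by apply: (addrI (act 0 (c (window i) a))); rewrite -(act_addl actP) !addr0.
Qed.

Lemma twist_right_action : right_action twist.
Proof.
split=> [a x y|x a b|x|x a b].
- exact: twist_addl.
- exact: twist_addr.
- by rewrite (twist_hom _ (mem_grading1 A_grading cP)) tau_0 (act_1 actP).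
have [_ gM] := A_grading.
rewrite {1}(comp_sum cP b) mulr_sumr twist_sumr.
rewrite [in RHS](comp_sum cP b) twist_sumr; apply: eq_bigr => j _.
rewrite {1}(comp_sum cP a) mulr_suml twist_sumr.
rewrite [in RHS](comp_sum cP a) twist_sumr twist_suml; apply: eq_bigr => i _.
have ai := comp_mem cP (window i) a; have bj := comp_mem cP (window j) b.
rewrite (twist_hom _ (gM _ _ _ _ ai bj)) (twist_hom _ ai) (twist_hom _ bj).
by rewrite (act_mul actP) addrC tauD -tau_act.
Qed.

Variables (m d : nat) (rho : A -> 'M[k]_m) (s : A -> 'M[k]_d).
Hypothesis rhoP : representation rho.
Hypothesis sP : representation s.

(** [emb] induces a map from M[t,1/t] to the twisted module, y t^i going to tau i (emb y). Followed
    by p it has components pi i, and the composite with io is a sum over all degrees, to which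
    [factors_trace] applies. *)
Lemma factors_through (emb : 'rV[k]_m -> V) (p : V -> 'rV[k]_d)
    (io : int -> 'M[k]_(d, m)) (t : seq int) :
  gfamily A_ s rho io -> bounded io ->
  (forall x y, emb (x + y) = emb x + emb y) ->
  (forall x a, emb (x *m rho a) = act (emb x) a) ->
  (forall x y, p (x + y) = p x + p y) ->
  (forall x a, p (twist x a) = p x *m s a) ->
  exists2 th, factors A_ rho s th &
    forall x, x *m th 0 = p (\sum_(i <- t) tau i (emb (x *m io i))).
Proof.
move=> fio bio embD emb_act pD ps.
pose phi j y := p (tau j (emb y)).
have phi_act n a j y : a \in A_ n -> phi (j + n) (y *m rho a) = phi j y *m s a.
  move=> an; rewrite /phi emb_act tauD -ps; congr p.
  by rewrite (twist_hom _ an) -tau_act -!tauD addrC.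
have phiD j x y : phi j (x + y) = phi j x + phi j y.
  by rewrite /phi embD tau_add pD.
have phiZ j x y : phi j (x *: y) = x *: phi j y.
  rewrite -[in RHS]mul_mx_scalar -(rep_scalar sP) -(phi_act 0) ?addr0.
    by rewrite (rep_scalar rhoP) mul_mx_scalar.
  by rewrite memvZ// (mem_grading1 A_grading cP).
pose pi j := matrix_of (phi j).
have piE j y : y *m pi j = phi j y by apply: mul_matrix_of.
have fpi : gfamily A_ rho s pi.
  move=> n a i an; apply/row_matrixP => l.
  by rewrite !rowE !mulmxA !piE phi_act.
have [th fth th0] := factors_trace t fio bio fpi.
exists th => // x; rewrite th0 mulmx_sumr.
have p0 : p 0 = 0 by apply: (addrI (p 0)); rewrite -pD !addr0.
rewrite (big_morph p pD p0); apply: eq_bigr => i _.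
by rewrite mulmxA piE.
Qed.

End TwistedAction.

Definition icoef (i : int) (p : {poly k}) : k := if i is Posz j then p`_j else 0.

Lemma icoefD i p q : icoef i (p + q) = icoef i p + icoef i q.
Proof. by case: i => j /=; rewrite ?coefD ?addr0. Qed.

Lemma icoefCM i x p : icoef i (x%:P * p) = x * icoef i p.
Proof. by case: i => j /=; rewrite ?coefCM ?mulr0. Qed.

Lemma icoef_sum i (I : Type) (t : seq I) (f : I -> {poly k}) :
  icoef i (\sum_(l <- t) f l) = \sum_(l <- t) icoef i (f l).
Proof.
by apply: (big_morph (icoef i) (icoefD i)); case: i => j /=; rewrite ?coef0.
Qed.

Lemma icoef_XnM u v (p q : {poly k}) i : 'X^u * p = 'X^v * q ->
  icoef (i + v%:Z) p = icoef (i + u%:Z) q.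
Proof.
move=> pq; have icoefX w (r : {poly k}) N : icoef N ('X^w * r) = icoef (N - w%:Z) r.
  case: N => N; last by rewrite (_ : Negz N - w%:Z = Negz (N + w))//; lia.
  rewrite /icoef coefXnM; case: ltnP => lt_N.
    by rewrite (_ : N%:Z - w%:Z = Negz (w - N).-1)//; lia.
  by rewrite subzn.
have := icoefX u p (i + u%:Z + v%:Z); rewrite pq icoefX addrK => ->.
by rewrite addrAC addrK.
Qed.

(** G is a linear map from X to M[t,1/t] with values in M[t]. Since n may be negative, t^n is
    written as the quotient of t^v by t^u. *)
Lemma poly_family m d (rho : A -> 'M[k]_m) (s : A -> 'M[k]_d)
    (G : 'M[{poly k}]_(d, m)) :
  (forall n a, a \in A_ n -> exists u v : nat, n = v%:Z - u%:Z /\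
     'X^u *: (map_mx polyC (s a) *m G) = 'X^v *: (G *m map_mx polyC (rho a))) ->
  gfamily A_ s rho (fun i => map_mx (icoef i) G) /\
  bounded (fun i => map_mx (icoef i) G).
Proof.
move=> GP; split=> [n a i an|].
  have [u [v [-> E]]] := GP n a an; apply/matrixP => x y.
  have := congr1 (fun M : 'M_(_, _) => M x y) E; rewrite mxE [RHS]mxE.
  move=> /(icoef_XnM (i - u%:Z)); rewrite subrK.
  rewrite !mxE !icoef_sum addrA addrAC => E'; transitivity
    (\sum_j icoef (i - u%:Z + v%:Z) (map_mx polyC (s a) x j * G j y)).
    by apply: eq_bigr => j _; rewrite !mxE icoefCM addrAC.
  rewrite E'; apply: eq_bigr => j _.
  by rewrite !mxE mulrC icoefCM mulrC.
exists (\max_x \max_y size (G x y))%N => i iB; apply/matrixP => x y.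
rewrite !mxE; case: i iB => j //= jB; apply: nth_default.
apply: leq_trans (ltnW jB); apply: leq_trans (leq_bigmax x).
exact: (leq_bigmax (F := fun y => size (G x y)) y).
Qed.

Lemma poly_matrix_coefs m d (G : 'M[{poly k}]_(d, m)) : exists N,
  G = \sum_(j < N) 'X^j *: map_mx polyC (map_mx (icoef j) G).
Proof.
pose N := (\max_x \max_y size (G x y))%N; exists N.
apply/matrixP => x y; rewrite summxE; under eq_bigr => j _ do rewrite !mxE.
have leN : (size (G x y) <= N)%N.
  apply: leq_trans (leq_bigmax x).
  exact: (leq_bigmax (F := fun y => size (G x y)) y).
transitivity (\poly_(j < N) (G x y)`_j).
  apply/polyP => j; rewrite coef_poly; case: ltnP => // ltNj.
  by rewrite nth_default// (leq_trans leN).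
by rewrite poly_def; apply: eq_bigr => j _; rewrite mulrC mul_polyC.
Qed.

End Twist.

Lemma fraction_repr (R : idomainType) (x : {fraction R}) :
  exists n d : R, d != 0 /\ x * FracField.tofrac d = FracField.tofrac n.
Proof.
elim/quotW: x => x; exists (\n_x), (\d_x); split; first exact: denom_ratioP.
apply/eqP; rewrite -[_ * _]/(FracField.mul _ _) !piE FracField.equivfE.
rewrite /FracField.mulf !numden_Ratio ?mulr1 ?oner_eq0 ?denom_ratioP//.
by rewrite mulrC.
Qed.

Lemma common_denominator (R : idomainType) (I : finType) (f : I -> {fraction R}) :
  exists d : R, d != 0 /\
    forall i, exists n, f i * FracField.tofrac d = FracField.tofrac n.
Proof.
have /choice[n /choice[d nd]] := fun i => fraction_repr (f i).
exists (\prod_i d i); split.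
  by apply/prodf_neq0 => i _; have [] := nd i.
move=> i; have [_ E] := nd i.
exists (n i * \prod_(j | j != i) d j).
by rewrite (bigD1 i)//= !rmorphM/= mulrA E.
Qed.

(** * The generic module *)

Section GenericModule.
Variables (k : fieldType) (A : falgType k) (A_ : int -> {vspace A}).
Hypothesis A_grading : algebra_grading A_.
Variables (D : nat) (c : int -> A -> A).
Hypothesis cP : components A_ D c.
Variables (m : nat) (rho : A -> 'M[k]_m).
Hypothesis rhoP : representation rho.
Hypothesis m_gt0 : (0 < m)%N.
Hypothesis no_summand : forall q, graded_idempotents A_ rho q -> forall i, q i = 0.

Local Notation K := {fraction {poly k}}.
Local Notation tofrac := (@FracField.tofrac {poly k}).

Let cst : {rmorphism k -> K} := (tofrac \o polyC)%FUN.
Let t : K := tofrac 'X.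

Let t_neq0 : t != 0. Proof. by rewrite tofrac_eq0 polyX_eq0. Qed.

Let act (x : 'rV[K]_m) (a : A) := x *m map_mx cst (rho a).
Let tau (n : int) (x : 'rV[K]_m) := (t ^ n) *: x.

Let actP : right_action act.
Proof.
split=> [a x y|x a b|x|x a b]; rewrite /act.
- exact: mulmxDl.
- by rewrite (repD rhoP) map_mxD mulmxDr.
- by rewrite (rep_1 rhoP) map_mx1 mulmx1.
- by rewrite (rep_mul rhoP) map_mxM mulmxA.
Qed.

Let tau_add n x y : tau n (x + y) = tau n x + tau n y.
Proof. exact: scalerDr. Qed.
Let tau_0 x : tau 0 x = x.
Proof. by rewrite /tau expr0z scale1r. Qed.
Let tauD i j x : tau (i + j) x = tau i (tau j x).
Proof. by rewrite /tau expfzDr// scalerA. Qed.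
Let tau_act n x a : tau n (act x a) = act (tau n x) a.
Proof. exact: scalemxAl. Qed.

Let twistP := twist_right_action A_grading cP actP tau_add tau_0 tauD tau_act.
Let Q : rmodType A := action_module twistP.

Let twistZ f x a : twist D c act tau (f *: x) a = f *: twist D c act tau x a.
Proof.
rewrite /twist scaler_sumr; apply: eq_bigr => i _.
by rewrite /act /tau -scalemxAl !scalerA mulrC.
Qed.

(** Scalars of k(t) are endomorphisms of Q, so endomorphism-stable subgroups are k(t)-subspaces. *)
Let Q_ranked : endo_ranked Q.
Proof.
exists (fun S => lin_rank (S : set 'rV[K]_m)) => S T.
have lin (U : set Q) : endo_stable U -> lin_closed (U : set 'rV[K]_m).
  move=> [U0 UD Uf]; split=> // f x y Ux Uy; apply: (UD _ _ _ Uy).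
  pose g (z : Q) : Q := f *: (z : 'rV[K]_m).
  have gL : linear g.
    move=> a z z'; rewrite /g [LHS]scalerDr; congr (_ + _).
    by rewrite -[LHS]twistZ.
  pose gM := GRing.isLinear.Build A^c Q Q _ g gL.
  pose G : {linear Q -> Q} := HB.pack g gM.
  exact: (Uf G).
by move=> /lin Sl /lin Tl; apply: lin_rank_lt.
Qed.

Let Q_nonzero : nonzero Q.
Proof.
exists (const_mx 1 : 'rV[K]_m); apply/eqP => /matrixP/(_ 0 (Ordinal m_gt0)).
by rewrite !mxE => /eqP; rewrite oner_eq0.
Qed.

(** With a common denominator [den], i maps G into den^-1 M[t]. Hence the identity p i of G factors
    through M[t,1/t]; being nilpotent, it is zero. *)
Let no_fg_summand (G : rmodType A) : summand Q G -> nonzero G ->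
  ~ finitely_generated G.
Proof.
move=> [i [p ip]] [x0 x00] /fg_carried[d [s [f [sP fP]]]].
have [[g fg gf] fD fs] := fP.
have gD x y : g (x + y) = g x + g y.
  by apply: (can_inj fg); rewrite gf fD !gf.
have gs x a : g (ract x a) = g x *m s a.
  by apply: (can_inj fg); rewrite gf fs gf.
have A1 := mem_grading1 A_grading cP.
have ractQ n (x : Q) a : a \in A_ n ->
    ract x a = t ^ n *: (x : 'rV_m) *m map_mx cst (rho a).
  move=> an; rewrite ractE (twist_hom cP actP tau_add _ an).
  exact: scalemxAl.
pose Phi : 'M[K]_(d, m) := \matrix_l (i (f (delta_mx 0 l)) : 'rV[K]_m).
have PhiE x : (i (f x) : 'rV[K]_m) = map_mx cst x *m Phi.
  have ifD u v : (i (f (u + v)) : 'rV[K]_m) = i (f u) + i (f v).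
    by rewrite fD linearD.
  have if0 : (i (f 0) : 'rV[K]_m) = 0.
    by apply: (addrI (i (f 0) : 'rV[K]_m)); rewrite -ifD !addr0.
  rewrite mulmx_sum_row {1}(row_sum_delta x).
  rewrite (big_morph (fun u => i (f u) : 'rV[K]_m) ifD if0).
  apply: eq_bigr => l _; rewrite rowK mxE (carried_scale sP _ _ fP) linear_ract.
  rewrite (ractQ 0) ?memvZ// expr0z scale1r (rep_scalar rhoP).
  by rewrite map_scalar_mx mul_mx_scalar.
have [den [den0 denP]] := common_denominator (fun lj : 'I_d * 'I_m => Phi lj.1 lj.2).
have /choice[num numP] := denP.
pose G0 : 'M[{poly k}]_(d, m) := \matrix_(l, j) num (l, j).
have G0E : map_mx tofrac G0 = tofrac den *: Phi.
  by apply/matrixP => l j; rewrite mxE [G0 _ _]mxE [RHS]mxE -numP/= mulrC.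
have map_cst (r n : nat) (M : 'M[k]_(r, n)) :
    map_mx cst M = map_mx tofrac (map_mx polyC M).
  by rewrite -map_mx_comp.
have map_tofrac_inj (r n : nat) (M M' : 'M[{poly k}]_(r, n)) :
    map_mx tofrac M = map_mx tofrac M' -> M = M'.
  move=> /matrixP MM'; apply/matrixP => a b; have := MM' a b.
  by rewrite !mxE => /eqP; rewrite tofrac_eq => /eqP.
have PhiA n a : a \in A_ n ->
    map_mx cst (s a) *m Phi = t ^ n *: (Phi *m map_mx cst (rho a)).
  move=> an; apply/row_matrixP => l; rewrite !rowE mulmxA.
  have dE : map_mx cst (delta_mx 0 l : 'rV[k]_d) = delta_mx 0 l.
    by rewrite map_delta_mx.
  rewrite -dE -map_mxM -PhiE fs linear_ract (ractQ n)// PhiE.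
  by rewrite -scalemxAr -scalemxAl !mulmxA.
have [fio bio] : gfamily A_ s rho (fun i => map_mx (icoef i) G0) /\
    bounded (fun i => map_mx (icoef i) G0).
  apply: poly_family => n a an.
  have [u [v nE]] : exists u v : nat, n = v%:Z - u%:Z.
    by case: n {an} => n; [exists 0%N, n|exists n.+1, 0%N]; lia.
  exists u, v; split=> //; apply: map_tofrac_inj.
  rewrite !map_mxZ !map_mxM -!map_cst G0E !rmorphXn/=.
  rewrite -scalemxAr (PhiA n)// -scalemxAl !scalerA; congr (_ *: _).
  rewrite mulrAC; congr (_ * _).
  rewrite nE -[_ ^+ v]/(t ^ v%:Z) -[_ ^+ u]/(t ^ u%:Z) -expfzDr//.
  by congr (_ ^ _); lia.
pose emb (y : 'rV[k]_m) : 'rV[K]_m := (tofrac den)^-1 *: map_mx cst y.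
pose P (x : 'rV[K]_m) : 'rV[k]_d := g (p x).
have [N G0sum] := poly_matrix_coefs G0.
have [||||th fth th1] := factors_through A_grading cP actP
  tau_add tauD tau_act rhoP sP (emb := emb) (p := P)
  [seq Posz i | i <- iota 0 N] fio bio.
- by move=> x y; rewrite /emb map_mxD scalerDr.
- by move=> x a; rewrite /emb /act map_mxM scalemxAl.
- by move=> x y; rewrite /P (linearD p) gD.
- by move=> x a; rewrite /P -gs -linear_ract.
have sumE x : \sum_(j <- [seq Posz i | i <- iota 0 N])
    tau j (emb (x *m map_mx (icoef j) G0)) = i (f x).
  rewrite PhiE -[Phi](scalerK (a := tofrac den)) ?tofrac_eq0// -G0E.
  rewrite -scalemxAr map_cst -map_mxM [in RHS]G0sum mulmx_sumr raddf_sum.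
  rewrite scaler_sumr big_map -{1}[N]subn0 -/(index_iota 0 N) big_mkord.
  apply: eq_bigr => j _; rewrite /tau /emb map_cst scalerA mulrC -scalerA.
  congr (_ *: _); rewrite -scalemxAr /= map_mxZ rmorphXn/=; congr (_ *: _).
  by rewrite !map_mxM.
have th1E : th 0 = 1%:M.
  by apply/row_matrixP => l; rewrite !rowE mulmx1 th1 sumE /P ip fg.
have [e] := factors_nil no_summand fth.
rewrite th1E expr1n => M0; move/eqP: x00; apply.
have g0 : g x0 = 0 by rewrite -[g x0]mulmx1 [1%:M]M0 mulmx0.
by rewrite -[x0]gf g0; apply: (addrI (f 0)); rewrite -fD !addr0.
Qed.

Theorem generic_module_exists : exists G : rmodType A, generic G.
Proof.
have [G QG Gind] := indecomposable_summand Q_ranked Q_nonzero.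
exists G; split=> //.
  exact/endo_ranked_finite_length/(summand_endo_ranked QG).
by apply: no_fg_summand => //; case: Gind.
Qed.

End GenericModule.

(** * The Pruefer module *)

Section IntegerIterates.
Variables (T : Type) (f g : T -> T).
Hypotheses (fg : cancel f g) (gf : cancel g f).

Definition int_iter (n : int) : T -> T :=
  match n with Posz n => iter n f | Negz n => iter n.+1 g end.

Lemma int_iterS n x : int_iter (n + 1) x = f (int_iter n x).
Proof.
case: n => [n|[|n]]; first by rewrite -PoszD addn1.
  by rewrite /= gf.
rewrite (_ : Negz n.+1 + 1 = Negz n); last by lia.
by rewrite /= gf.
Qed.

Lemma int_iterP n x : int_iter (n - 1) x = g (int_iter n x).
Proof. by rewrite -{2}[n](subrK 1) int_iterS fg. Qed.

Lemma int_iterD i j x : int_iter (i + j) x = int_iter i (int_iter j x).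
Proof.
elim/int_rect: i => [|n IHn|n IHn]; first by rewrite add0r.
  by rewrite -addn1 PoszD addrAC !int_iterS IHn.
by rewrite -addn1 PoszD opprD addrAC !int_iterP IHn.
Qed.

Lemma int_iter_comm (h : T -> T) : (forall x, h (f x) = f (h x)) ->
  forall n x, h (int_iter n x) = int_iter n (h x).
Proof.
move=> hf; have hg x : h (g x) = g (h x) by rewrite -[LHS]fg -hf gf.
move=> n x; elim/int_rect: n => [//|n IHn|n IHn].
  by rewrite -addn1 PoszD !int_iterS hf IHn.
by rewrite -addn1 PoszD opprD !int_iterP hg IHn.
Qed.

End IntegerIterates.

(* {poly k} with the operator drop_poly 1 stands for k[s^-1] s^-1, the
   coefficient of 'X^i being that of s^-(i+1); its multiplication by s is
   drop_poly 1, and mult_t is the multiplication by t = 1 + s. *)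
Section PrueferPolynomials.
Variable k : fieldType.
Implicit Types p q : {poly k}.

Definition mult_t p := p + drop_poly 1 p.

(** The geometric series of 1 / (1 + s), finite because s^(size p) kills p. *)
Definition mult_tV p := \sum_(i < size p) (-1) ^+ i *: drop_poly i p.

Lemma drop_poly1_add i p : drop_poly 1 (drop_poly i p) = drop_poly i.+1 p.
Proof. by apply/polyP => j; rewrite !coef_drop_poly; congr (p`_ _); lia. Qed.

Lemma mult_tD p q : mult_t (p + q) = mult_t p + mult_t q.
Proof. by rewrite /mult_t drop_polyD addrACA. Qed.

Lemma mult_tZ c p : mult_t (c *: p) = c *: mult_t p.
Proof. by rewrite /mult_t drop_polyZ scalerDr. Qed.

Lemma mult_tVK : cancel mult_tV mult_t.
Proof.
move=> p; rewrite /mult_t /mult_tV drop_poly_sum -big_split/=.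
under eq_bigr do rewrite drop_polyZ drop_poly1_add.
rewrite (eq_bigr (fun i : 'I_(size p) =>
    (-1) ^+ i *: drop_poly i p - (-1) ^+ i.+1 *: drop_poly i.+1 p)).
  have E n : \sum_(i < n) ((-1) ^+ i *: drop_poly i p -
      (-1) ^+ i.+1 *: drop_poly i.+1 p) = p - (-1) ^+ n *: drop_poly n p.
    elim: n => [|n IHn].
      by rewrite big_ord0 expr0 scale1r drop_poly0l subrr.
    by rewrite big_ord_recr/= IHn addrA subrK.
  by rewrite E [drop_poly _ _]drop_poly_eq0// scaler0 subr0.
by move=> i _; rewrite exprS mulN1r scaleNr opprK.
Qed.

Lemma mult_t_inj : injective mult_t.
Proof.
move=> p q pq; apply/subr0_eq; set r := p - q.
have r0 : r = - drop_poly 1 r.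
  apply/eqP; rewrite -subr_eq0 opprK -/(mult_t r) /r mult_tD pq -mult_tD subrr.
  by rewrite /mult_t drop_poly0r addr0.
have : size r = (size r - 1)%N by rewrite {1}r0 size_polyN size_drop_poly.
move=> E; apply/eqP; rewrite -size_poly_eq0; move: E; clearbody r.
by case: (size r) => // n E; exfalso; lia.
Qed.

Lemma mult_tK : cancel mult_t mult_tV.
Proof. by move=> p; apply: mult_t_inj; rewrite mult_tVK. Qed.

Definition power_t (n : int) : {poly k} -> {poly k} := int_iter mult_t mult_tV n.

Lemma power_tD i j p : power_t (i + j) p = power_t i (power_t j p).
Proof. exact: (int_iterD mult_tK mult_tVK). Qed.

Lemma power_tZ n c p : power_t n (c *: p) = c *: power_t n p.
Proof.
apply/esym/(int_iter_comm mult_tK mult_tVK (h := fun p => c *: p)) => q.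
by rewrite mult_tZ.
Qed.

Lemma power_t_drop n p : power_t n (drop_poly 1 p) = drop_poly 1 (power_t n p).
Proof.
apply/esym/(int_iter_comm mult_tK mult_tVK (h := drop_poly 1)) => q.
by rewrite /mult_t drop_polyD.
Qed.

Lemma power_t_add n p q : power_t n (p + q) = power_t n p + power_t n q.
Proof.
have tVD u v : mult_tV (u + v) = mult_tV u + mult_tV v.
  by apply: mult_t_inj; rewrite mult_tD !mult_tVK.
elim/int_rect: n => [//|n IHn|n IHn]; rewrite -addn1 PoszD.
  by rewrite /power_t !(int_iterS mult_tVK) -mult_tD -IHn.
by rewrite opprD /power_t !(int_iterP mult_tK mult_tVK) -tVD -IHn.
Qed.

Lemma power_t0 n : power_t n 0 = 0.
Proof. by rewrite -(scale0r 0) power_tZ !scale0r. Qed.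

Lemma power_t_sum n (I : Type) (r : seq I) (f : I -> {poly k}) :
  power_t n (\sum_(i <- r) f i) = \sum_(i <- r) power_t n (f i).
Proof. exact: (big_morph _ (power_t_add n) (power_t0 n)). Qed.

Lemma power_tMC n p c : power_t n (p * c%:P) = power_t n p * c%:P.
Proof. by rewrite ![_ * c%:P]mulrC !mul_polyC power_tZ. Qed.

Definition eval_t (w q : {poly k}) : {poly k} :=
  \sum_(j < size q) q`_j *: power_t j w.

Lemma eval_t_wide w q N : (size q <= N)%N ->
  eval_t w q = \sum_(j < N) q`_j *: power_t j w.
Proof.
move=> leN; rewrite /eval_t (big_ord_widen N (fun j => q`_j *: power_t j w))//.
rewrite [RHS](bigID (fun j : 'I_N => (j < size q)%N))/= [X in _ + X]big1 ?addr0//.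
by move=> j; rewrite -leqNgt => /(nth_default 0) ->; rewrite scale0r.
Qed.

Lemma eval_tD w p q : eval_t w (p + q) = eval_t w p + eval_t w q.
Proof.
have [le_pq le_p le_q] : [/\ (size (p + q)%R <= maxn (size p) (size q))%N,
    (size p <= maxn (size p) (size q))%N & (size q <= maxn (size p) (size q))%N].
  by rewrite size_polyD leq_maxl leq_maxr.
rewrite (eval_t_wide w le_pq) (eval_t_wide w le_p) (eval_t_wide w le_q) -big_split.
by apply: eq_bigr => j _; rewrite coefD scalerDl.
Qed.

Lemma eval_tMXaddC w q c : eval_t w (q * 'X + c%:P) = mult_t (eval_t w q) + c *: w.
Proof.
have le_q : (size (q * 'X + c%:P)%R <= (size q).+1)%N.
  by rewrite size_MXaddC; case: ifP.
rewrite (eval_t_wide w le_q) big_ord_recl/= coefD coefMX coefC/= add0r.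
rewrite addrC; congr (_ + _).
rewrite (big_morph mult_t mult_tD (power_t0 1)); apply: eq_bigr => j _.
by rewrite coefD coefMX coefC/= addr0 mult_tZ.
Qed.

(** As s = t - 1, substituting X - 1 turns a polynomial in s into one in t. *)
Lemma eval_t_compXsub1 w q :
  eval_t w (q \Po ('X - 1)) = \sum_(j < size q) q`_j *: drop_poly j w.
Proof.
pose es q' := \sum_(j < size q') q'`_j *: drop_poly j w.
have es_wide q' N : (size q' <= N)%N -> es q' = \sum_(j < N) q'`_j *: drop_poly j w.
  move=> leN; rewrite /es (big_ord_widen N (fun j => q'`_j *: drop_poly j w))//.
  rewrite [RHS](bigID (fun j : 'I_N => (j < size q')%N))/= [X in _ + X]big1 ?addr0//.
  by move=> j; rewrite -leqNgt => /(nth_default 0) ->; rewrite scale0r.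
rewrite -/(es q); elim/poly_ind: q => [|q c IHq].
  by rewrite comp_poly0 /eval_t /es size_poly0 !big_ord0.
have le_q : (size (q * 'X + c%:P)%R <= (size q).+1)%N.
  by rewrite size_MXaddC; case: ifP.
have -> : es (q * 'X + c%:P) = drop_poly 1 (es q) + c *: w.
  rewrite (es_wide _ _ le_q) big_ord_recl/= coefD coefMX coefC/= add0r.
  rewrite drop_poly0l addrC; congr (_ + _).
  rewrite /es drop_poly_sum; apply: eq_bigr => j _.
  by rewrite coefD coefMX coefC/= addr0 drop_polyZ drop_poly1_add.
rewrite comp_poly_MXaddC -IHq; set r := q \Po _.
have -> : r * ('X - 1) + c%:P = (r * 'X + c%:P) + (-1)%:P * r.
  by rewrite polyCN; ring.
rewrite eval_tD eval_tMXaddC mul_polyC scaleN1r.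
have -> : eval_t w (- r) = - eval_t w r.
  by apply: (addrI (eval_t w r)); rewrite -eval_tD !subrr /eval_t size_poly0 big_ord0.
by rewrite /mult_t; ring.
Qed.

(* Multiplying by s^N an element of the Pruefer module gives a polynomial in s,
   rewritten here as a polynomial in t. *)
Definition reverse_t (N : nat) p : {poly k} :=
  (\poly_(i < N) p`_(N.-1 - i)) \Po ('X - 1).

Lemma reverse_tD N p q : reverse_t N (p + q) = reverse_t N p + reverse_t N q.
Proof.
rewrite /reverse_t -comp_polyD; congr (_ \Po _); apply/polyP => i.
by rewrite coefD !coef_poly; case: ifP; rewrite ?addr0// coefD.
Qed.

Lemma reverse_tCM N c p : reverse_t N (c%:P * p) = c%:P * reverse_t N p.
Proof.
rewrite /reverse_t !mul_polyC -comp_polyZ; congr (_ \Po _); apply/polyP => i.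
by rewrite coefZ !coef_poly; case: ifP; rewrite ?mulr0// coefZ.
Qed.

Lemma size_reverse_t N p : (size (reverse_t N p) <= N)%N.
Proof.
rewrite size_comp_poly2; first exact: size_poly.
by rewrite -polyC1 size_XsubC.
Qed.

(** 'X^(N.-1) stands for s^-N, so evaluation undoes the multiplication by s^N. *)
Lemma reverse_tK N p : (size p <= N)%N ->
  eval_t 'X^(N.-1) (reverse_t N p) = p.
Proof.
move=> leN; rewrite eval_t_compXsub1.
set q := \poly_(i < N) _; have le_q : (size q <= N)%N by apply: size_poly.
transitivity (\sum_(j < N) q`_j *: drop_poly j 'X^(N.-1) : {poly k}).
  rewrite (big_ord_widen N (fun j => q`_j *: drop_poly j 'X^(N.-1) : {poly k}))//.
  rewrite [RHS](bigID (fun j : 'I_N => (j < size q)%N))/= [X in _ + X]big1 ?addr0//.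
  by move=> j; rewrite -leqNgt => /(nth_default 0) ->; rewrite scale0r.
rewrite (reindex_inj rev_ord_inj)/= -[RHS](coefK p) poly_def.
rewrite (big_ord_widen N (fun j => p`_j *: 'X^j : {poly k}))//.
rewrite [RHS]big_mkcond; apply: eq_bigr => j _.
have -> : q`_(N - j.+1) = p`_j.
  by rewrite coef_poly; case: ltnP => [_|]; [congr (p`_ _)|]; have := ltn_ord j; lia.
have -> : drop_poly (N - j.+1) 'X^(N.-1) = 'X^j :> {poly k}.
  have -> : N.-1 = (j + (N - j.+1))%N by have := ltn_ord j; lia.
  by rewrite exprD drop_polyMXn_id.
by case: ltnP => // /(nth_default 0) ->; rewrite scale0r.
Qed.

(** The condition on the coefficient of s^-1: its product with s is 0 in the Pruefer module, whereas
    after multiplication by s^N it would remain. *)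
Lemma reverse_t_mult N p : (size p <= N)%N -> p`_0 = 0 ->
  reverse_t N (mult_t p) = 'X * reverse_t N p.
Proof.
move=> leN p0; rewrite /reverse_t.
set q := \poly_(i < N) p`_(N.-1 - i).
have -> : \poly_(i < N) (mult_t p)`_(N.-1 - i) = q * ('X + 1).
  rewrite mulrDr mulr1; apply/polyP => i; rewrite coefD coefMX !coef_poly.
  rewrite coefD coef_drop_poly; case: i => [|i] /=.
    rewrite add0r subn0; case: ltnP => // N0.
    by rewrite addn1 prednK// [p`_N]nth_default// addr0.
  case: (ltnP i.+1 N) => iN.
    rewrite (ltnW iN) addrC; congr (p`_ _ + _); lia.
  rewrite addr0; case: ltnP => // iN'.
  by rewrite (_ : N.-1 - i = 0)%N ?p0//; lia.
have X1 : ('X + 1) \Po ('X - 1) = 'X :> {poly k}.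
  by rewrite -{1}polyC1 comp_polyD comp_polyX comp_polyC polyC1 subrK.
by rewrite comp_polyM X1 mulrC.
Qed.

(** Each multiplication by t uses up one vanishing coefficient. *)
Lemma reverse_t_power N n p : (size p <= N)%N ->
  (forall i, (i < n)%N -> p`_i = 0) ->
  reverse_t N (power_t n p) = 'X^n * reverse_t N p.
Proof.
move=> leN; elim: n => [|n IHn] p_low; first by rewrite mul1r.
have lowP e : (e <= n)%N -> (size (power_t e p) <= N)%N /\
    forall i, (i < n.+1 - e)%N -> (power_t e p)`_i = 0.
  elim: e => [|e IHe] len; first by split=> // i iN; apply: p_low; lia.
  have [le_size low] := IHe (ltnW len); split.
    rewrite /power_t /= /mult_t (leq_trans (size_polyD _ _))// geq_max le_size.
    by rewrite size_drop_poly (leq_trans (leq_subr _ _)).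
  move=> i ilt; rewrite /power_t /= /mult_t coefD coef_drop_poly.
  by rewrite !low ?addr0//; lia.
have [le_size low] := lowP n (leqnn n).
rewrite [LHS](_ : _ = reverse_t N (mult_t (power_t n p)))//.
rewrite reverse_t_mult//; last by apply: low; lia.
by rewrite IHn => [|i lti]; [rewrite mulrA -exprS|apply: p_low; lia].
Qed.

End PrueferPolynomials.

Section CopowerSums.
Local Open Scope classical_set_scope.
Local Open Scope ring_scope.
Variables (R : pzRingType) (I : Type) (X : lmodType R).

Let single_finsupp (i : {classic I}) (x : X) :
  ((fun i' : {classic I} => if i' == i then x else 0) : I -> X)
    \in @finsupp_pred R I X.
Proof.
rewrite inE; apply: sub_finite_set (finite_set1 i) => i' /=.
by case: (i' =P i) => // _ /eqP.
Qed.

Definition copower_single i x : copower I X := Copower (single_finsupp i x).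

Lemma copower_singleD i x y :
  copower_single i (x + y) = copower_single i x + copower_single i y.
Proof.
apply: val_inj; apply/funext => j /=.
rewrite [RHS](_ : _ = (if (j : {classic I}) == i then x else 0) +
  (if (j : {classic I}) == i then y else 0))//.
by case: eqP; rewrite ?addr0.
Qed.

Lemma copower_singleZ i a x : copower_single i (a *: x) = a *: copower_single i x.
Proof.
apply: val_inj; apply/funext => j /=.
rewrite [RHS](_ : _ = a *: (if (j : {classic I}) == i then x else 0))//.
by case: eqP; rewrite ?scaler0.
Qed.

Lemma copower_sum (y : copower I X) : exists t : seq I,
  y = \sum_(i <- t) copower_single i (copower_val y i).
Proof.
have : finite_set [set i : {classic I} | copower_val y i != 0].
  by have := valP y; rewrite inE.
move=> /finite_seqP[t tE]; exists (undup t).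
apply: val_inj; rewrite raddf_sum /=; apply/funext => j.
rewrite fct_sumE /=.
have tj : copower_val y j != 0 -> (j : {classic I}) \in t.
  by move=> yj; have : [set` t] (j : {classic I}) by rewrite -tE.
have ut := undup_uniq t; rewrite -mem_undup in tj.
case: (boolP ((j : {classic I}) \in undup t)) => jt.
  rewrite (bigD1_seq (j : {classic I}))//= eqxx.
  by rewrite big1 ?addr0// => i /negPf; rewrite eq_sym => ->.
have -> : copower_val y j = 0 by apply/eqP; apply: contraNT jt.
rewrite (@big1_seq _ _ _ {classic I})// => i /andP[_ it]; case: eqP => // ji.
by rewrite ji it in jt.
Qed.

End CopowerSums.

Section PrueferModule.
Local Open Scope classical_set_scope.
Local Open Scope ring_scope.
Variables (k : fieldType) (A : falgType k) (A_ : int -> {vspace A}).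
Hypothesis A_grading : algebra_grading A_.
Variables (D : nat) (c : int -> A -> A).
Hypothesis cP : components A_ D c.
Variables (m : nat) (rho : A -> 'M[k]_m).
Hypothesis rhoP : representation rho.
Hypothesis m_gt0 : (0 < m)%N.
Hypothesis no_summand : forall q, graded_idempotents A_ rho q -> forall i, q i = 0.

Let act (x : 'rV[{poly k}]_m) (a : A) := x *m map_mx polyC (rho a).
Let tau (n : int) (x : 'rV[{poly k}]_m) : 'rV[{poly k}]_m := map_mx (power_t n) x.

Let actP : right_action act.
Proof.
split=> [a x y|x a b|x|x a b]; rewrite /act.
- exact: mulmxDl.
- by rewrite (repD rhoP) map_mxD mulmxDr.
- by rewrite (rep_1 rhoP) map_mx1 mulmx1.
- by rewrite (rep_mul rhoP) map_mxM mulmxA.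
Qed.

Let tau_add n x y : tau n (x + y) = tau n x + tau n y.
Proof. by apply/matrixP => a b; rewrite !mxE power_t_add. Qed.
Let tau_0 x : tau 0 x = x.
Proof. by apply/matrixP => a b; rewrite !mxE. Qed.
Let tauD i j x : tau (i + j) x = tau i (tau j x).
Proof. by apply/matrixP => a b; rewrite !mxE power_tD. Qed.

Let map_power n r d e (x : 'M[{poly k}]_(r, d)) (M : 'M[k]_(d, e)) :
  map_mx (power_t n) (x *m map_mx polyC M) = map_mx (power_t n) x *m map_mx polyC M.
Proof.
apply/matrixP => a b; rewrite !mxE power_t_sum; apply: eq_bigr => j _.
by rewrite !mxE power_tMC.
Qed.

Let tau_act n x a : tau n (act x a) = act (tau n x) a.
Proof. exact: map_power. Qed.

Let twistP := twist_right_action A_grading cP actP tau_add tau_0 tauD tau_act.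
Let P : rmodType A := action_module twistP.

Let A1 := mem_grading1 A_grading cP.

Let P_hom n (x : P) a : a \in A_ n -> ract x a = tau n (act x a).
Proof. by move=> an; rewrite ractE (twist_hom cP actP tau_add _ an). Qed.

Let P_scale (x : P) (b : k) : ract x b%:A = b%:P *: (x : 'rV[{poly k}]_m).
Proof.
rewrite (@P_hom 0) ?memvZ// tau_0 /act (rep_scalar rhoP).
by rewrite map_scalar_mx mul_mx_scalar.
Qed.

Let mult_s (x : P) : P := map_mx (drop_poly 1) (x : 'rV[{poly k}]_m).

Let mult_s_linear : linear mult_s.
Proof.
apply: ract_linear => [x y|x a].
  by apply/matrixP => i j; rewrite !mxE drop_polyD.
rewrite !ractE /twist.
have msD u v : mult_s (u + v) = mult_s u + mult_s v.
  by apply/matrixP => i j; rewrite !mxE drop_polyD.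
have ms0 : mult_s 0 = 0 by apply/matrixP => i j; rewrite !mxE drop_poly0r.
rewrite (big_morph mult_s msD ms0); apply: eq_bigr => i _.
apply/matrixP => u v; rewrite !mxE -power_t_drop; congr power_t.
rewrite drop_poly_sum; apply: eq_bigr => j _; rewrite !mxE.
by rewrite ![_ * _%:P]mulrC !mul_polyC drop_polyZ.
Qed.

Let P_prufer : prufer P.
Proof.
pose sM := GRing.isLinear.Build A^c P P _ mult_s mult_s_linear.
pose phi : {linear P -> P} := HB.pack mult_s sM.
have phiE x : phi x = mult_s x by [].
exists phi; split.
- move=> x; exists (\max_j size ((x : 'rV[{poly k}]_m) 0%R j))%N.
  have iterE n : (iter n phi x : 'rV[{poly k}]_m) =
      map_mx (drop_poly n) (x : 'rV[{poly k}]_m).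
    elim: n => [|n IHn]; first by apply/matrixP => i j; rewrite mxE drop_poly0l.
    rewrite iterS phiE /mult_s IHn; apply/matrixP => i j.
    by rewrite !mxE drop_poly1_add.
  rewrite iterE; apply/matrixP => i j; rewrite !mxE ord1 drop_poly_eq0//.
  exact: (leq_bigmax (F := fun j => size ((x : 'rV[{poly k}]_m) 0 j)) j).
- move=> y; exists (map_mx (fun p => p * 'X^1) (y : 'rV[{poly k}]_m)).
  by apply/matrixP => i j; rewrite !mxE drop_polyMXn_id.
- exists (const_mx 1 : 'rV[{poly k}]_m).
    by apply/matrixP => i j; rewrite !mxE drop_poly_eq0// size_poly1.
  apply/eqP => /matrixP/(_ 0 (Ordinal m_gt0)).
  by rewrite !mxE => /eqP; rewrite oner_eq0.
(* The kernel of s is M s^-1, the vectors of constants; its submodules are measured by their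
   dimension over k. *)
pose low (T : set P) : set 'rV[k]_m := [set v | T (map_mx polyC v)].
have low_lin T : submod_closed [in T] -> lin_closed (low T).
  move=> [T0 TD]; rewrite inE in T0; split; first by rewrite /low /= map_mx0.
  move=> b x y Tx Ty; rewrite /low /=.
  have := TD (b%:A : A) (map_mx polyC x) (map_mx polyC y); rewrite !inE.
  move=> /(_ Tx Ty); congr T; rewrite map_mxD map_mxZ; congr (_ + _).
  exact: P_scale.
apply: (@rank_finite_length _ _ _ (fun T => lin_rank (low T))).
  move=> T T' Tcl Tcl' [sTT' nsTT'] sT'; apply: lin_rank_lt; try exact: low_lin.
  split=> [x|sub]; first exact: sTT'.
  apply: nsTT' => x T'x; have sx : mult_s x = 0 := sT' _ T'x.
  have xE : x = map_mx polyC (map_mx (coefp 0) (x : 'rV[{poly k}]_m)).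
    apply/matrixP => i j; rewrite !mxE; apply: size1_polyC.
    have := congr1 (fun z : 'rV[{poly k}]_m => z i j) sx; rewrite !mxE => /eqP.
    by rewrite -size_poly_eq0 size_drop_poly subn_eq0.
  by rewrite xE; apply: sub; rewrite /low /= -xE.
split=> [|a x y]; rewrite !inE; first exact: (linear0 phi).
move=> sx sy; apply: (etrans (linearP phi a x y)).
by rewrite (sx : phi x = 0) (sy : phi y = 0) scaler0 addr0.
Qed.

(* A linear map X -> P whose coefficients at s^-1, ..., s^-D vanish lifts to a
   linear map from X to M[t,1/t][s^-1]. *)
Let lifting (X_dim : nat) (s : A -> 'M[k]_X_dim) (R : 'M[{poly k}]_(X_dim, m))
    (ka : P -> 'rV[k]_X_dim) :
  representation s ->
  (forall x a, (map_mx polyC (x *m s a) *m R : P) =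
     ract (map_mx polyC x *m R : P) a) ->
  (forall l j n, (n < D)%N -> (R l j)`_n = 0) ->
  (forall x y, ka (x + y) = ka x + ka y) ->
  (forall x a, ka (ract x a) = ka x *m s a) ->
  exists2 th, factors A_ rho s th &
    forall x, x *m th 0 = ka (map_mx polyC x *m R : P).
Proof.
move=> sP R_act R_low kaD ka_act.
pose N := (\max_l \max_j size (R l j))%N.
have leN l j : (size (R l j) <= N)%N.
  apply: leq_trans (leq_bigmax l).
  exact: (leq_bigmax (F := fun j => size (R l j)) j).
pose low (p : {poly k}) := (size p <= N)%N /\ forall n, (n < D)%N -> p`_n = 0.
have low0 : low 0 by split=> [|n _]; rewrite ?size_poly0 ?coef0.
have lowD p q : low p -> low q -> low (p + q).
  move=> [lp p0] [lq q0]; split=> [|n nD]; last by rewrite coefD p0// q0// addr0.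
  by rewrite (leq_trans (size_polyD _ _))// geq_max lp.
have lowC (b : k) p : low p -> low (b%:P * p).
  move=> [lp p0]; split=> [|n nD]; last by rewrite coefCM p0// mulr0.
  by rewrite mul_polyC (leq_trans (size_scale_leq _ _)).
have lowR l j : low (R l j) by split=> // n; apply: R_low.
have low_mull e (M : 'M[k]_(e, X_dim)) l j : low ((map_mx polyC M *m R) l j).
  by rewrite mxE; elim/big_ind: _ => // i _; rewrite !mxE; apply: lowC.
have low_mulr e (M : 'M[k]_(m, e)) l j : low ((R *m map_mx polyC M) l j).
  by rewrite mxE; elim/big_ind: _ => // i _; rewrite !mxE mulrC; apply: lowC.
pose G : 'M[{poly k}]_(X_dim, m) := map_mx (reverse_t N) R.
have rev0 : reverse_t N (0 : {poly k}) = 0.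
  by apply: (addrI (reverse_t N 0)); rewrite -reverse_tD !addr0.
have rev_mull e (M : 'M[k]_(e, X_dim)) :
    map_mx (reverse_t N) (map_mx polyC M *m R) = map_mx polyC M *m G.
  apply/matrixP => l j; rewrite !mxE (big_morph _ (@reverse_tD _ N) rev0).
  by apply: eq_bigr => i _; rewrite !mxE reverse_tCM.
have rev_mulr e (M : 'M[k]_(m, e)) :
    map_mx (reverse_t N) (R *m map_mx polyC M) = G *m map_mx polyC M.
  apply/matrixP => l j; rewrite !mxE (big_morph _ (@reverse_tD _ N) rev0).
  by apply: eq_bigr => i _; rewrite !mxE mulrC reverse_tCM mulrC.
have rev_power d e (n : nat) (Z : 'M[{poly k}]_(d, e)) : (n <= D)%N ->
    (forall l j, low (Z l j)) ->
    map_mx (reverse_t N) (map_mx (power_t n) Z) = 'X^n *: map_mx (reverse_t N) Z.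
  move=> nD lowZ; apply/matrixP => l j; rewrite !mxE.
  have [leZ Z0] := lowZ l j; rewrite reverse_t_power// => i lti.
  by apply: Z0; apply: leq_trans nD.
have R_hom n a : a \in A_ n ->
    map_mx polyC (s a) *m R = map_mx (power_t n) (R *m map_mx polyC (rho a)).
  move=> an; rewrite map_power; apply/row_matrixP => l; rewrite !row_mul -map_row.
  rewrite [row l (s a)]rowE R_act (P_hom _ an) tau_act /act /tau map_delta_mx.
  by rewrite -rowE map_row.
have [fio bio] : gfamily A_ s rho (fun i => map_mx (icoef i) G) /\
    bounded (fun i => map_mx (icoef i) G).
  (* Beyond D only a = 0 is homogeneous. Up to D the vanishing coefficients let [reverse_t] commute
     with t^n; for negative n the power of t is moved to the other side. *)
  apply: poly_family => n a an; have [nD|nD] := ltnP D `|n|.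
    have a0 : a = 0 by rewrite -(comp_id cP an) (comp_out cP).
    have [u [v nE]] : exists u v : nat, n = v%:Z - u%:Z.
      by case: n {an nD} => n; [exists 0%N, n|exists n.+1, 0%N]; lia.
    exists u, v; split=> //.
    by rewrite a0 !rep0// !map_mx0 mul0mx mulmx0 !scaler0.
  have := R_hom n a an; case: n an nD => n an nD Rn.
    exists 0%N, n; split; first by rewrite subr0.
    by rewrite expr0 scale1r -rev_mull Rn rev_power// rev_mulr.
  exists n.+1, 0%N; split; first by rewrite sub0r NegzE.
  rewrite expr0 scale1r -rev_mull -rev_power// Rn -rev_mulr; congr map_mx.
  apply/matrixP => l j; rewrite !mxE -power_tD.
  by rewrite (_ : n.+1%:Z + Negz n = 0)//; lia.
pose w : {poly k} := 'X^(N.-1).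
pose emb (y : 'rV[k]_m) : 'rV[{poly k}]_m := w *: map_mx polyC y.
have [||||th fth thE] := factors_through A_grading cP actP
  tau_add tauD tau_act rhoP sP (emb := emb) (p := ka)
  [seq Posz i | i <- iota 0 N] fio bio.
- by move=> x y; rewrite /emb map_mxD scalerDr.
- by move=> x a; rewrite /emb /act map_mxM scalemxAl.
- exact: kaD.
- by move=> x a; rewrite -ka_act.
exists th => // x; rewrite thE; congr ka.
rewrite big_map -{1}[N]subn0 -/(index_iota 0 N) big_mkord.
apply/matrixP => i j; rewrite summxE ord1.
have [leN' _] := low_mull _ x 0 j.
rewrite -[RHS](reverse_tK leN') (eval_t_wide _ (size_reverse_t N _)).
have revE : reverse_t N ((map_mx polyC x *m R) 0 j) = (map_mx polyC x *m G) 0 j.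
  by rewrite -rev_mull [RHS]mxE.
apply: eq_bigr => l _; rewrite revE mxE [emb _ _ _]mxE [map_mx polyC _ _ _]mxE.
rewrite mulrC mul_polyC power_tZ; congr (_ *: _).
rewrite [LHS]mxE [(map_mx polyC x *m G) _ _]mxE coef_sum; apply: eq_bigr => l' _.
by rewrite [map_mx (icoef l) G _ _]mxE [map_mx polyC x _ _]mxE coefCM.
Qed.

(** The composites pi i (ka i w) sum to w. Modulo combinations of finitely many pi (g l), each pi i
    lifts, so its composites with the ka i' lie in the nilpotent S. Descending through S leaves only
    values of size at most N0, whereas sizes in P are unbounded. *)
Let P_not_finite_type : ~ finite_type P.
Proof.
move=> [X [I [N [X_fl [f [h fh hf]]]]]].
have [d [s [j [sP jP]]]] := fg_carried (finite_length_fg X_fl).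
have [[jr jrK jK] jD js] := jP.
have jrD x y : jr (x + y) = jr x + jr y.
  by apply: (can_inj jrK); rewrite jK jD !jK.
have jr_act x a : jr (ract x a) = jr x *m s a.
  by apply: (can_inj jrK); rewrite jK js jK.
have hD x y : h (x + y) = h x + h y.
  by apply: (can_inj fh); rewrite hf linearD !hf.
have hZ a x : h (a *: x) = a *: h x.
  by apply: (can_inj fh); rewrite hf linearZ /= hf.
have h0 : h 0 = 0 by apply: (addrI (h 0)); rewrite -hD !addr0.
pose pi i x : P := (h (copower_single i (j x))).1.
pose ka i (w : P) := jr (copower_val (f (w, 0)) i).
have piD i x y : pi i (x + y) = pi i x + pi i y.
  by rewrite /pi jD copower_singleD hD.
have pi_act i x a : pi i (x *m s a) = ract (pi i x) a.
  by rewrite /pi js copower_singleZ hZ.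
have kaD i x y : ka i (x + y) = ka i x + ka i y.
  rewrite /ka -jrD; congr (jr _).
  have -> : (x + y, 0) = (x, 0) + (y, 0) :> (P * N)%type.
    by rewrite [RHS](_ : _ = (x + y, 0 + 0))// addr0.
  by rewrite (linearD f).
have ka_act i x a : ka i (ract x a) = ka i x *m s a.
  rewrite /ka -jr_act; congr (jr _).
  have -> : (ract x a, 0) = (a : A^c) *: (x, 0) :> (P * N)%type.
    by rewrite [RHS](_ : _ = (ract x a, (a : A^c) *: 0))// scaler0.
  by rewrite linearZ.
have pi_ka w : exists t : seq I, w = \sum_(i <- t) pi i (ka i w).
  have [t tE] := copower_sum (f (w, 0)); exists t.
  have := congr1 (fun y => (h y).1) tE; rewrite /= fh /= (big_morph h hD h0).
  rewrite (big_morph fst (fun x y => erefl _) (erefl _)) => {1}->.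
  by apply: eq_bigr => i _; rewrite /pi /ka jK.
have piZ i b x : pi i (b *: x) = b%:P *: (pi i x : 'rV[{poly k}]_m).
  rewrite -P_scale -pi_act (rep_scalar sP); congr (pi i _).
  by rewrite mul_mx_scalar.
have pi0 i : pi i 0 = 0 by apply: (addrI (pi i 0)); rewrite -piD !addr0.
pose F i : 'M[{poly k}]_(d, m) := \matrix_l (pi i (delta_mx 0 l) : 'rV[{poly k}]_m).
have piE i x : (pi i x : 'rV[{poly k}]_m) = map_mx polyC x *m F i.
  rewrite mulmx_sum_row {1}(row_sum_delta x) (big_morph (pi i) (piD i) (pi0 i)).
  by apply: eq_bigr => l _; rewrite rowK mxE piZ.
pose T := ('I_d * 'I_m * 'I_D)%type.
pose ev (l : 'I_#|{: T}|) : T := enum_val l.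
(* The coefficients at s^-1, ..., s^-D of pi i, as a vector in a space of finite dimension
   independent of i. *)
pose v i : 'rV[k]_#|{: T}| := \row_l (F i (ev l).1.1 (ev l).1.2)`_((ev l).2).
have [r [B [Bv vB]]] := ex_span [set z | exists i, z = v i].
have /choice[g gE] : forall l, exists i, row l B = v i by [].
pose N0 := (\max_l \max_a \max_b size (F (g l) a b))%N.
have leN0 l a b : (size (F (g l) a b) <= N0)%N.
  apply: leq_trans (leq_bigmax l); apply: leq_trans (leq_bigmax a).
  exact: (leq_bigmax (F := fun b => size (F (g l) a b)) b).
pose U (w : P) := forall b, (size ((w : 'rV[{poly k}]_m) 0%R b) <= N0)%N.
have U0 : U 0 by move=> b; rewrite mxE size_poly0.
have UD x y : U x -> U y -> U (x + y).
  move=> Ux Uy b; rewrite mxE (leq_trans (size_polyD _ _))//.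
  by rewrite geq_max Ux Uy.
have UZ b (w : 'rV[{poly k}]_m) : U w -> U (b%:P *: w).
  by move=> Uw e; rewrite mxE mul_polyC (leq_trans (size_scale_leq _ _)).
have Ug l x : U (pi (g l) x).
  rewrite piE => b; rewrite mxE; elim/big_ind: _ => [|p q lp lq|a _].
  - by rewrite size_poly0.
  - by rewrite (leq_trans (size_polyD _ _))// geq_max lp.
  - by rewrite mxE mul_polyC (leq_trans (size_scale_leq _ _)).
pose S (_ _ : unit) : set 'M[k]_d :=
  [set z | exists2 th, factors A_ rho s th & th 0 = z].
have [q kq] : exists q, forall i x, killed S q i x.
  apply: nil_killed => [i i'|i i' i2 x y [th fth <-] [th' fth' <-]|i x [th fth <-]].
  - split; first by exists (fun=> 0) => //; apply: factors0.
    move=> a x y [th fth <-] [th' fth' <-]; exists (fun i => a *: th i + th' i) => //.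
    exact/factorsD/fth'/factorsZ.
  - exists (fun i => th i *m th' i) => //.
    exact/factors_mulr/(factors_gfamily fth').
  - exact: (factors_nil no_summand fth).
have UK e : forall x, killed S e tt x -> forall i, U (pi i x).
  elim: e => [|e IHe] x kx i; first by rewrite (kx : x = 0) pi0.
  have /submxP[b vE] : (v i <= B)%MS by apply: vB; exists i.
  (* R has no coefficients at s^-1, ..., s^-D, so [lifting] puts ka i' (x R) in x S, which is killed
     in one step fewer. *)
  pose R := F i - \sum_l (b 0 l)%:P *: F (g l).
  have FE : F i = R + \sum_l (b 0 l)%:P *: F (g l) by rewrite subrK.
  have RE y : (map_mx polyC y *m R : P) =
      pi i y - (\sum_l (b 0 l)%:P *: (pi (g l) y : 'rV[{poly k}]_m) : P).
    rewrite /R mulmxBr mulmx_sumr [pi i y]piE; congr (_ - _).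
    by apply: eq_bigr => l _; rewrite -scalemxAr piE.
  have R_act y a : (map_mx polyC (y *m s a) *m R : P) =
      ract (map_mx polyC y *m R : P) a.
    rewrite !RE ractDl pi_act; congr (_ + _).
    have -> : ract (- (\sum_l (b 0 l)%:P *: (pi (g l) y : 'rV[{poly k}]_m)) : P) a =
        - ract (\sum_l (b 0 l)%:P *: (pi (g l) y : 'rV[{poly k}]_m) : P) a.
      exact: (@scalerN A^c P).
    congr (- _); under [in RHS]eq_bigr do rewrite -P_scale.
    rewrite ract_suml; apply: eq_bigr => l _.
    by rewrite pi_act -P_scale -!ractM mulr_algl mulr_algr.
  have R_low a e' n : (n < D)%N -> (R a e')`_n = 0.
    move=> nD; pose l : 'I_#|{: T}| := enum_rank ((a, e', Ordinal nD) : T).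
    have := congr1 (fun z : 'rV[k]_#|{: T}| => z 0 l) vE.
    rewrite mulmx_sum_row summxE [v i _ _]mxE /ev enum_rankK /= => E.
    rewrite [R _ _]mxE [X in _ + X]mxE coefB E summxE coef_sum.
    apply/eqP; rewrite subr_eq0; apply/eqP; apply: eq_bigr => l' _.
    by rewrite gE [LHS]mxE [v _ _ _]mxE /ev enum_rankK [in RHS]mxE coefCM.
  rewrite piE FE mulmxDr; apply: (UD); last first.
    rewrite mulmx_sumr; elim/big_ind: _ => [|y z|l _]; [exact: U0|exact: UD|].
    by rewrite -scalemxAr -piE; apply: UZ.
  have [t ->] := pi_ka (map_mx polyC x *m R : P).
  elim/big_ind: _ => [|y z|i' _]; [exact: U0|exact: UD|apply: IHe].
  have [th fth <-] := lifting sP R_act R_low (kaD i') (ka_act i').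
  by apply: (kx tt); exists th.
have UT w : U w.
  have [t ->] := pi_ka w.
  by elim/big_ind: _ => [|y z|i _]; [exact: U0|exact: UD|apply: (UK q)].
have := UT (const_mx 'X^N0 : 'rV[{poly k}]_m) (Ordinal m_gt0).
by rewrite mxE size_polyXn ltnn.
Qed.

Theorem pruefer_module_exists : exists P : rmodType A, prufer P /\ ~ finite_type P.
Proof. by exists P; split; [apply: P_prufer|apply: P_not_finite_type]. Qed.

End PrueferModule.

Theorem corollary6p7 (k : fieldType) (A : falgType k) (A_ : int -> {vspace A})
    (A_grading : algebra_grading A_)
    (M : rmodType A) (M_fg : finitely_generated M)
    (M_not_gradable : ~ gradable A_ M) :
  (exists P : rmodType A, prufer P /\ ~ finite_type P) /\
  (exists G : rmodType A, generic G).
Proof.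
have [D [c cP]] := grading_components A_grading.
have [d [s [f [sP fP]]]] := fg_carried M_fg.
have [|m [rho [rhoP m_gt0 no_summand]]] := ungradable_part cP sP.
  move=> [q [B [qP qB q1]]]; apply: M_not_gradable.
  exact: (idempotents_gradable sP fP qP qB q1).
split.
  exact: (pruefer_module_exists A_grading cP rhoP m_gt0 no_summand).
exact: (generic_module_exists A_grading cP rhoP m_gt0 no_summand).
Qed.
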